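(* Let $\mathcal{A}=\{H_1,\dots,H_n\}$ be a real line arrangement in $\mathbb{R}^2$ with coordinates, numbering and defining equations $\alpha_0=-1,\alpha_1,\dots,\alpha_n$ normalized as in the context, and let $S_1,\dots,S_n\subset M(\mathcal{A})$ be the closed $3$-dimensional submanifolds $S_i=S(\alpha_{i-1},\alpha_i)\cap M(\mathcal{A})$. Then the following hold. (i) For $i\neq j$, $S_i$ and $S_j$ intersect transversely, and $S_i\cap S_j=\bigsqcup C$, where $C$ runs over all chambers $C\in\mathsf{ch}(\mathcal{A})$ satisfying $\alpha_i(C)\alpha_{i-1}(C)<0$ and $\alpha_j(C)\alpha_{j-1}(C)<0$. (ii) For each $i=1,\dots,n$, $$S_i^\circ:=S_i\setminus\bigcup_{C\in\mathsf{ch}_2^{\mathcal{F}}(\mathcal{A})}C$$ is a contractible $3$-manifold. (iii) $U:=M(\mathcal{A})\setminus\bigcup_{i=1}^n S_i$ is a contractible $4$-manifold.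
   Context: Setting. $\mathcal{A}=\{H_1,\dots,H_n\}$ is a finite set of distinct affine lines in $\mathbb{R}^2$. Coordinates $(x_1,x_2)$ are chosen with $\mathcal{F}^0=\{(0,0)\}$ and $\mathcal{F}^1=\{x_2=0\}$, the flag $\emptyset\subset\mathcal{F}^0\subset\mathcal{F}^1\subset\mathcal{F}^2=\mathbb{R}^2$ being generic with respect to $\mathcal{A}$ (in particular no $H_i$ is parallel to $\mathcal{F}^1$), so that: all intersection points of lines of $\mathcal{A}$ lie in $\{x_2>0\}$; $H_i\cap\mathcal{F}^1=\{(a_i,0)\}$ with $0<a_n<a_{n-1}<\dots<a_1$. Each $\alpha_i$ ($1\le i\le n$) is a real polynomial of degree $1$ with $H_i=\{\alpha_i=0\}$ and with sign chosen so that $\alpha_i(0,0)<0$. By convention $\alpha_0=-1$ (constant). A chamber is a connected component of $\mathbb{R}^2\setminus\bigcup_i H_i$; $\mathsf{ch}(\mathcal{A})$ is the set of chambers and $\mathsf{ch}_2^{\mathcal{F}}(\mathcal{A})=\{C\in\mathsf{ch}(\mathcal{A})\mid C\cap\mathcal{F}^1=\emptyset\}$. For a chamber $C$, $\alpha_i(C)<0$ (resp. $>0$) means $\alpha_i$ is negative (resp. positive) on $C$; the sign of $\alpha_i(C)\alpha_{i-1}(C)$ is understood accordingly. $M(\mathcal{A})=\mathbb{C}^2\setminus\bigcup_{i}\{z\in\mathbb{C}^2\mid\alpha_i(z)=0\}$ is the complexified complement, and chambers are regarded as subsets of $M(\mathcal{A})$ via $\mathbb{R}^2\subset\mathbb{C}^2$.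 For linearly independent nonzero polynomials $\alpha,\beta$ of degree $\le1$ on $\mathbb{C}^2$, the sail is $$S(\alpha,\beta)=\{z\in\mathbb{C}^2\mid \alpha(z)\beta(z)\neq0,\ \alpha(z)/\beta(z)\in\mathbb{R}_{<0}\},$$ and $S_i=S(\alpha_{i-1},\alpha_i)\cap M(\mathcal{A})$ for $i=1,\dots,n$. *)

(* Defs.v *)
From HB Require Import structures.
From mathcomp Require Import all_boot all_order all_algebra.
From mathcomp Require Import all_classical all_reals all_analysis.
From mathcomp Require Import complex.

Set Implicit Arguments.
Unset Strict Implicit.
Unset Printing Implicit Defensive.

Import Order.TTheory GRing.Theory Num.Theory.
Import numFieldNormedType.Exports.

Local Open Scope classical_set_scope.
Local Open Scope ring_scope.

Notation plane R := ('rV[R]_2).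
(* (x, y) stands for the point x + i y of C^2, so that C^2 carries the topology
   and the smooth structure of the real normed space R^2 * R^2. *)
Notation cplane R := ('rV[R]_2 * 'rV[R]_2)%type.

Section Differential.
Variable R : realType.

(* [:: v1; ...; vk] |-> D_v1 (D_v2 ... (D_vk f)) *)
Definition iter_derive (V W : normedModType R) (s : seq V) (f : V -> W)
  : V -> W := foldr (fun v g => 'D_v g) f s.

(* C^oo on an open set A of a finite-dimensional space V (in infinite dimension
   directional derivatives would not be the right notion). *)
Definition smooth_on (V W : normedModType R) (A : set V) (f : V -> W) : Prop :=
  forall (s : seq V) (x : V), A x ->
    {for x, continuous (iter_derive s f)} /\
    forall v, derivable (iter_derive s f) x v.

(* Every point of S has a neighbourhood in S diffeomorphic to an open subset O
   of R^d: g is the parametrization, and its inverse is the restriction of the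
   smooth map h defined on the open subset B of the ambient space. *)
Definition submanifold (V : normedModType R) (d : nat) (S : set V) : Prop :=
  forall p, S p ->
    exists (B : set V) (O : set 'rV[R]_d) (g : 'rV[R]_d -> V)
           (h : V -> 'rV[R]_d),
      [/\ open B, B p & open O] /\
      [/\ smooth_on O g, smooth_on B h, g @` O = S `&` B &
          forall u, O u -> h (g u) = u].

Definition tangent_space (V : normedModType R) (S : set V) (p : V) : set V :=
  [set v | exists (J : set R) (gamma : R -> V),
      [/\ open J, J 0 & smooth_on J gamma] /\
      [/\ gamma 0 = p, forall t, J t -> S (gamma t) & derive1 gamma 0 = v]].

(* The ambient manifold is V, or any open subset of V containing S and T. *)
Definition transverse (V : normedModType R) (S T : set V) : Prop :=
  forall p, S p -> T p -> forall v : V,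
    exists u w, [/\ tangent_space S p u, tangent_space T p w & v = u + w].

Definition contractible (T : topologicalType) (X : set T) : Prop :=
  exists (x0 : T) (h : R * T -> T),
    [/\ X x0,
        {within `[0, 1]%classic `*` X, continuous h},
        (forall t x, `[0, 1]%classic t -> X x -> X (h (t, x))),
        (forall x, X x -> h (0, x) = x) &
        (forall x, X x -> h (1, x) = x0)].

End Differential.

Definition closed_in (T : topologicalType) (S M : set T) : Prop :=
  exists2 Z : set T, closed Z & S = Z `&` M.

Section Arrangement.
Variable R : realType.

(* Real polynomials of degree at most 1 in two variables. *)
Record affpoly := AffPoly { aff_const : R ; aff_lin : 'rV[R]_2 }.

Definition aeval (p : affpoly) (x : plane R) : R :=
  aff_const p + \sum_(j < 2) aff_lin p 0 j * x 0 j.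

Definition ccoord (z : cplane R) (j : 'I_2) : R[i] := (z.1 0 j +i* z.2 0 j)%C.

Definition aevalC (p : affpoly) (z : cplane R) : R[i] :=
  (aff_const p)%:C%C + \sum_(j < 2) (aff_lin p 0 j)%:C%C * ccoord z j.

Definition zero_line (p : affpoly) : set (plane R) := [set x | aeval p x = 0].

Definition F1 : set (plane R) := [set x | x 0 1 = 0].

Definition planept (a b : R) : plane R :=
  \row_(j < 2) (if j == 0 then a else b).

Section WithPolynomials.
(* Only alpha 0, ..., alpha n and a 1, ..., a n are used. *)
Variables (n : nat) (alpha : nat -> affpoly) (a : nat -> R).

Local Notation H i := (zero_line (alpha i)).

(* F^0 misses every line; F^1 meets every line in exactly one point and misses
   every intersection point. *)
Definition generic_flag : Prop :=
  [/\ forall i, (1 <= i <= n)%N -> ~ H i 0,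
      forall i, (1 <= i <= n)%N -> exists x, H i `&` F1 = [set x] &
      forall i j x, (1 <= i <= n)%N -> (1 <= j <= n)%N -> i <> j ->
        H i x -> H j x -> ~ F1 x].

Record normalized : Prop := Normalized {
  normalized_alpha0 : alpha 0 = AffPoly (-1) 0 ;
  normalized_degree : forall i, (1 <= i <= n)%N -> aff_lin (alpha i) != 0 ;
  normalized_distinct : forall i j, (1 <= i <= n)%N -> (1 <= j <= n)%N ->
    i <> j -> H i <> H j ;
  normalized_generic : generic_flag ;
  normalized_upper : forall i j x, (1 <= i <= n)%N -> (1 <= j <= n)%N ->
    i <> j -> H i x -> H j x -> 0 < x 0 1 ;
  normalized_trace : forall i, (1 <= i <= n)%N -> H i `&` F1 = [set planept (a i) 0] ;
  normalized_pos : forall i, (1 <= i <= n)%N -> 0 < a i ;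
  normalized_decr : forall i j, (1 <= i)%N -> (i < j)%N -> (j <= n)%N -> a j < a i ;
  normalized_sign : forall i, (1 <= i <= n)%N -> aeval (alpha i) 0 < 0 }.

Definition real_complement : set (plane R) :=
  [set x | forall i, (1 <= i <= n)%N -> ~ H i x].

Definition complement : set (cplane R) :=
  [set z | forall i, (1 <= i <= n)%N -> aevalC (alpha i) z <> 0].

Definition chamber (C : set (plane R)) : Prop :=
  exists2 x, real_complement x & C = connected_component real_complement x.

Definition chamber2 (C : set (plane R)) : Prop :=
  chamber C /\ C `&` F1 = set0.

Definition neg_on (p : affpoly) (C : set (plane R)) : Prop :=
  forall x, C x -> aeval p x < 0.

Definition pos_on (p : affpoly) (C : set (plane R)) : Prop :=
  forall x, C x -> 0 < aeval p x.

(* p(C) q(C) < 0 *)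
Definition opposite_on (p q : affpoly) (C : set (plane R)) : Prop :=
  (neg_on p C /\ pos_on q C) \/ (pos_on p C /\ neg_on q C).

Definition real_points (C : set (plane R)) : set (cplane R) :=
  [set (x, 0) | x in C].

Definition sail (p q : affpoly) : set (cplane R) :=
  [set z | aevalC p z * aevalC q z <> 0 /\
           exists2 r : R, r < 0 & aevalC p z / aevalC q z = r%:C%C].

Definition S_ (i : nat) : set (cplane R) :=
  sail (alpha i.-1) (alpha i) `&` complement.

Definition S_circ (i : nat) : set (cplane R) :=
  S_ i `\` \bigcup_(C in chamber2) real_points C.

Definition U_ : set (cplane R) :=
  complement `\` \bigcup_(i in [set i | (1 <= i <= n)%N]) S_ i.

Definition chambers_ij (i j : nat) : set (set (plane R)) :=
  [set C | [/\ chamber C, opposite_on (alpha i) (alpha i.-1) C &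
               opposite_on (alpha j) (alpha j.-1) C]].

End WithPolynomials.
End Arrangement.

(* Main.v *)
Require Import Defs.
From HB Require Import structures.
From mathcomp Require Import all_boot all_order all_algebra.
From mathcomp Require Import all_classical all_reals all_analysis.
From mathcomp Require Import complex.
From mathcomp Require Import ring lra zify.

Set Implicit Arguments.
Unset Strict Implicit.
Unset Printing Implicit Defensive.

Import Order.TTheory GRing.Theory Num.Theory.
Import numFieldNormedType.Exports.

Local Open Scope classical_set_scope.
Local Open Scope ring_scope.

(* Up to positive factors alpha_k = z_1 + b_k z_2 - a_k, and all intersection
   points lie in x_2 > 0 exactly when b_k is nonincreasing in k. Write
   z = x + i y, alpha_k(z) = P_k + i Q_k.

   On S_i the number r = - alpha_(i-1) / alpha_i is positive, and (r, z_2) are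
   global coordinates; there P_k and Q_k are explicit with signs governed by the
   order of the a_k and b_k. This shows that two sails only meet in real
   points, and that S_i° is contracted by lowering x_2 below 0, where only the
   chamber C_i remains over y = 0.

   For fixed z_2, U is the complement in the z_1-line of a broken line which
   starts with a ray and has vertices a_k - b_k z_2. Translating x by multiples
   of y preserves U, so U deforms into its part over x_2 <= 0. There the
   vertices have decreasing real parts, hence the broken line is a graph over
   the real axis and the fibre of U over x is the y-plane, minus a line through
   0 unless x lies in the chamber of the origin. *)

(** * Rational maps and homotopies *)

(** [U] consists of the z for which, for every k, the segment from alpha_(k-1)(z) to alpha_k(z) in
    the complex plane misses 0. Membership in [U] is always obtained from this picture: all values
    lie in the left half-plane, or all nonconstant values lie on one side of the real axis, or the
    values are sheared. Indeed, replacing x by x + t y acts on all values at once by (P, Q) -> (P +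
    t Q, Q), a linear map that fixes alpha_0 = -1. The obstacle is that this shear cannot lower x_2
    when y_2 = 0. But over y = 0 the set [U] is the chamber of the origin, where another direction
    is available, and for y <> 0 with |y_1| >= K |y_2| (K above all |b_k|) every x is allowed. So
    the descent has to follow y only where |y_1| < K |y_2|, and the remaining freedom joins the two
    directions continuously. Over x_2 <= 0 the line to be avoided in the y-plane has an equation
    with coefficient 1 on y_1. Hence y can slide parallel to it onto the y_1-axis, continuously in
    x, after which everything scales to the origin. *)

Section RationalFunctions.
Variables (R : realType) (V : normedModType R).
Implicit Types (A : set V) (f g : V -> R).

(** [smooth_on] quantifies over all iterated directional derivatives. A class of functions closed
    under differentiation turns this into an induction on the list of directions. *)
Inductive rational_on A : (V -> R) -> Prop :=
| rational_cst c : rational_on A (fun=> c)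
| rational_lin f : (forall k u v, f (k *: u + v) = k * f u + f v) ->
    continuous f -> rational_on A f
| rational_add f g : rational_on A f -> rational_on A g ->
    rational_on A (fun x => f x + g x)
| rational_mul f g : rational_on A f -> rational_on A g ->
    rational_on A (fun x => f x * g x)
| rational_inv f : (forall x, A x -> f x != 0) -> rational_on A f ->
    rational_on A (fun x => (f x)^-1).

Lemma rational_opp A f : rational_on A f -> rational_on A (fun x => - f x).
Proof.
move=> Af; rewrite (_ : (fun _ => _) = (fun x => -1 * f x)).
  by apply: rational_mul => //; exact: rational_cst.
by apply/funext => x; rewrite mulN1r.
Qed.

Lemma rational_sqr A f : rational_on A f -> rational_on A (fun x => f x ^+ 2).
Proof. by move=> Af; exact: rational_mul. Qed.

Lemma is_derive_linear f (x v : V) :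
  (forall k u w, f (k *: u + w) = k * f u + f w) -> is_derive x v f (f v).
Proof.
move=> flin.
suff cvf : h^-1 *: ((f \o shift x) (h *: v) - f x) @[h --> (0:R)^'] --> f v.
  by split; [apply/cvg_ex; exists (f v) | apply: cvg_lim].
apply: cvg_near_cst; near=> h.
rewrite /= flin addrK [_ *: _]mulrA mulVf ?mul1r //.
by near: h; exact: nbhs_dnbhs_neq.
Unshelve. all: by end_near. Qed.

Lemma rational_derive A v f : rational_on A f ->
  exists2 g, rational_on A g &
    forall x, A x -> {for x, continuous f} /\ is_derive x v f (g x).
Proof.
elim=> {f}.
- move=> c; exists (fun=> 0); first exact: rational_cst.
  by move=> x _; split; [exact: cst_continuous | exact: is_derive_cst].
- move=> f flin fc; exists (fun=> f v); first exact: rational_cst.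
  by move=> x _; split; [exact: fc | exact: is_derive_linear].
- move=> f g _ [df Rdf fP] _ [dg Rdg gP].
  exists (fun x => df x + dg x); first exact: rational_add.
  move=> x Ax; have [cf Df] := fP x Ax; have [cg Dg] := gP x Ax.
  by split; [exact: continuousD | exact: is_deriveD].
- move=> f g Rf [df Rdf fP] Rg [dg Rdg gP].
  exists (fun x => f x * dg x + g x * df x).
    by apply: rational_add; exact: rational_mul.
  move=> x Ax; have [cf Df] := fP x Ax; have [cg Dg] := gP x Ax.
  by split; [exact: continuousM | exact: is_deriveM].
- move=> f f0 Rf [df Rdf fP].
  have Rfi := rational_inv f0 Rf.
  exists (fun x => - ((f x)^-1 * (f x)^-1) * df x).
    by apply: rational_mul => //; apply: rational_opp; exact: rational_mul.
  move=> x Ax; have [cf Df] := fP x Ax; have fx0 := f0 x Ax.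
  split; first exact: continuousV.
  have [Dfx dfE] := Df.
  split; first exact: derivableV.
  by rewrite deriveV // dfE -exprVn expr2.
Qed.

Lemma rational_continuous A f x :
  rational_on A f -> A x -> {for x, continuous f}.
Proof. by move=> /(rational_derive 0)[g _ /(_ x)] gP /gP[]. Qed.

Variable W : normedModType R.

Lemma is_derive_scale f (w : W) (x v : V) (df : R) :
  is_derive x v f df -> is_derive x v (fun y => f y *: w) (df *: w).
Proof.
move=> [fd fD].
suff cvf : h^-1 *: (((fun y => f y *: w) \o shift x) (h *: v) - f x *: w)
    @[h --> (0:R)^'] --> df *: w.
  by split; [apply/cvg_ex; exists (df *: w) | apply: cvg_lim].
rewrite (_ : (fun h => _) =
    (fun h => (h^-1 *: ((f \o shift x) (h *: v) - f x)) *: w)).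
  by apply: cvgZr_tmp; rewrite -fD; exact: fd.
by apply/funext => h /=; rewrite -scalerBl scalerA.
Qed.

(** Differentiation acts on the rational coefficients and leaves the constant vectors alone, so
    vector-valued maps of this shape also form a class closed under derivatives. *)
Definition lin_comb m (w : 'I_m -> W) (F : 'I_m -> V -> R) (x : V) : W :=
  \sum_(i < m) F i x *: w i.

Lemma lin_comb_derive A m (w : 'I_m -> W) (F : 'I_m -> V -> R) v :
  (forall i, rational_on A (F i)) ->
  exists2 G, (forall i, rational_on A (G i)) & forall x, A x ->
    {for x, continuous (lin_comb w F)} /\
    is_derive x v (lin_comb w F) (lin_comb w G x).
Proof.
move=> FR; pose G i := sval (cid2 (rational_derive v (FR i))).
have RG i : rational_on A (G i) by rewrite /G; case: cid2.
have GP i x : A x -> {for x, continuous (F i)} /\ is_derive x v (F i) (G i x).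
  by rewrite /G; case: cid2 => /= g _; apply.
exists G => // x Ax; split.
  rewrite /lin_comb /continuous_at; apply: cvg_big => [|i _]; first exact: add_continuous.
  by apply: cvgZr_tmp; exact: (GP i x Ax).1.
rewrite /lin_comb (_ : (fun x => _) = \sum_(i < m) (fun x => F i x *: w i)).
  by apply: is_derive_sum => i; apply: is_derive_scale; exact: (GP i x Ax).2.
by apply/funext => y; rewrite fct_sumE.
Qed.

(** By induction, each iterated derivative agrees on [A] with another such combination. Openness of
    [A] upgrades this to agreement near each point, which is what the next derivative sees. *)
Lemma smooth_lin_comb A m (w : 'I_m -> W) (F : 'I_m -> V -> R) :
  open A -> (forall i, rational_on A (F i)) -> smooth_on A (lin_comb w F).
Proof.
move=> Aopen FR s.
have [G GR sG] : exists2 G, (forall i, rational_on A (G i)) &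
    forall x, A x -> iter_derive s (lin_comb w F) x = lin_comb w G x.
  elim: s => [|v s [G GR sG]]; first by exists F.
  have [G' G'R GP] := lin_comb_derive w v GR.
  exists G' => // x Ax; rewrite /= -(derive_val (is_derive := (GP x Ax).2)).
  apply: near_eq_derive; near=> y; apply: sG.
  by near: y; exact: open_nbhs_nbhs.
move=> x Ax.
have eqG : \forall y \near x, lin_comb w G y = iter_derive s (lin_comb w F) y.
  near=> y; rewrite sG //.
  by near: y; exact: open_nbhs_nbhs.
split=> [|v]; have [G' _ /(_ x Ax)[cG dG]] := lin_comb_derive w 0 GR.
  rewrite /prop_for /continuous_at sG //.
  by apply: cvg_trans cG; exact: near_eq_cvg.
have [G'' _ /(_ x Ax)[_ dGv]] := lin_comb_derive w v GR.
by have [] := near_eq_is_derive eqG dGv.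
Unshelve. all: by end_near. Qed.

End RationalFunctions.

(** * Open pieces of submanifolds and piecewise straight contractions *)

Section Topology.
Variable R : realType.

Lemma submanifold_open (V : normedModType R) d (S W : set V) :
  open W -> submanifold d S -> submanifold d (S `&` W).
Proof.
move=> Wo Sd p [Sp Wp].
have [B [Q [g [h [[Bo Bp Oo] [gsm hsm imQ hg]]]]]] := Sd p Sp.
exists (B `&` W), (Q `&` g @^-1` W), g, h.
have gc u : Q u -> {for u, continuous g} by move=> /(gsm [::] u)[].
have OW : open (Q `&` g @^-1` W).
  rewrite openE => u [Ou Wu]; apply: filterI; first exact: open_nbhs_nbhs.
  by apply: (gc u Ou); exact: open_nbhs_nbhs.
split; first by split => //; exact: openI.
split=> [s u [Ou _]|s u [Bu _]||u [Ou _]]; [exact: gsm|exact: hsm| |exact: hg].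
apply/seteqP; split=> [_ [u [Ou Wu] <-]|q [[Sq Wq] [Bq _]]].
  have : (S `&` B) (g u) by rewrite -imQ; exists u.
  by case=> ? ?; split; split.
have : (S `&` B) q by [].
by rewrite -imQ => -[u Ou guq]; exists u => //; split=> //=; rewrite guq.
Qed.

Definition clamp (t : R) := Num.max 0 (Num.min 1 t).

Lemma clamp0 t : t <= 0 -> clamp t = 0.
Proof. by rewrite /clamp minEle maxEle; do 2![case: ifP]; lra. Qed.

Lemma clamp1 t : 1 <= t -> clamp t = 1.
Proof. by rewrite /clamp minEle maxEle; do 2![case: ifP]; lra. Qed.

Lemma clamp_itv t : 0 <= clamp t <= 1.
Proof. by rewrite /clamp minEle maxEle; do 2![case: ifP]; lra. Qed.

Lemma continuous_clamp (T : topologicalType) (f : T -> R) (x : T) :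
  {for x, continuous f} -> {for x, continuous (fun y => clamp (f y))}.
Proof.
move=> cf; apply: (@continuous_max R T (fun=> 0) _ x); first exact: cst_continuous.
by apply: (@continuous_min R T (fun=> 1) f x) => //; exact: cst_continuous.
Qed.

(* Concatenates three straight-line homotopies of E, and transports the result
   to X along the homeomorphism hh. *)
Lemma contractible_3steps (V W : normedModType R) (X : set V) (E : set W)
    (g : W -> V) (hh : V -> W) (f1 f2 : W -> W) (w0 : W) :
  E w0 -> (forall u, E u -> X (g u)) -> (forall x, X x -> E (hh x)) ->
  (forall x, X x -> g (hh x) = x) ->
  (forall u, E u -> {for u, continuous g}) ->
  (forall x, X x -> {for x, continuous hh}) ->
  (forall u, E u -> {for u, continuous f1}) ->
  (forall u, E u -> {for u, continuous f2}) ->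
  (forall u t, E u -> 0 <= t <= 1 -> E (u + t *: (f1 u - u))) ->
  (forall u t, E u -> 0 <= t <= 1 -> E (f1 u + t *: (f2 u - f1 u))) ->
  (forall u t, E u -> 0 <= t <= 1 -> E (f2 u + t *: (w0 - f2 u))) ->
  contractible R X.
Proof.
move=> Ew0 EX XE hhK cg chh cf1 cf2 E1 E2 E3.
(* Leg number [i], counted from 0, runs while t goes from i/3 to (i+1)/3. Adding the three legs
   avoids gluing, so [F] is continuous as a sum. *)
pose k i (t : R) := clamp (3 * t - i%:R).
pose F (p : R * W) := p.2 + k 0 p.1 *: (f1 p.2 - p.2)
  + k 1 p.1 *: (f2 p.2 - f1 p.2) + k 2 p.1 *: (w0 - f2 p.2).
have FE t u : E u -> E (F (t, u)).
  move=> Eu; rewrite /F /=.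
  have [t0|t0] := leP (3 * t) 1.
    rewrite [k 1 _]clamp0 ?[k 2 _]clamp0 ?scale0r ?addr0; try lra.
    by apply: E1 => //; exact: clamp_itv.
  have [t1|t1] := leP (3 * t) 2.
    rewrite [k 0 _]clamp1 ?[k 2 _]clamp0 ?scale0r ?addr0 ?scale1r; try lra.
    by rewrite subrKC; apply: E2 => //; exact: clamp_itv.
  rewrite [k 0 _]clamp1 ?[k 1 _]clamp1 ?scale1r; try lra.
  rewrite !subrKC.
  by apply: E3 => //; exact: clamp_itv.
have kc i (p : R * W) : {for p, continuous (fun p : R * W => k i p.1)}.
  apply: continuous_clamp; apply: continuousB; last exact: cst_continuous.
  by apply: continuousM; [exact: cst_continuous | exact: cvg_fst].
have Fc t u : E u -> {for (t, u), continuous F}.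
  move=> Eu; have c2 : {for (t, u), continuous (fun p : R * W => p.2)}.
    exact: cvg_snd.
  have c3 : {for (t, u), continuous (fun p : R * W => f1 p.2)}.
    by apply: (continuous_comp c2); exact: cf1.
  have c4 : {for (t, u), continuous (fun p : R * W => f2 p.2)}.
    by apply: (continuous_comp c2); exact: cf2.
  rewrite /F; apply: continuousD; first apply: continuousD; first apply: continuousD => //.
  - by apply: continuousZ; [exact: kc | exact: continuousB].
  - by apply: continuousZ; [exact: kc | exact: continuousB].
  - apply: continuousZ; [exact: kc | apply: continuousB => //].
    exact: cst_continuous.
exists (g w0), (fun p => g (F (p.1, hh p.2))); split.
- exact: EX.
- apply: continuous_in_subspaceT => -[t x]; rewrite inE => -[/= _ Xx].
  apply: (@continuous_comp _ _ _ (fun p : R * V => F (p.1, hh p.2)) g); last first.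
    by apply: cg; apply: FE; exact: XE.
  apply: (@continuous_comp _ _ _ (fun p : R * V => (p.1, hh p.2)) F); last first.
    by apply: Fc; exact: XE.
  apply: (@cvg_pair _ _ _ (nbhs (t, x)) (nbhs t) (nbhs (hh x))).
    exact: cvg_fst.
  apply: (@cvg_comp _ _ _ snd hh _ (nbhs x)); first exact: cvg_snd.
  exact: chh.
- by move=> t x _ Xx /=; apply: EX; apply: FE; exact: XE.
- move=> x Xx /=; rewrite /F /= /k !clamp0; [|lra..].
  by rewrite !scale0r !addr0 hhK.
- move=> x Xx /=; rewrite /F /= /k !clamp1; [|lra..].
  by rewrite !scale1r !subrKC.
Qed.

Lemma line_segment_connected (V : normedModType R) (x y : V) :
  connected [set x + t *: (y - x) | t in `[0, 1]%classic].
Proof.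
apply: connected_continuous_connected; first exact: segment_connected.
apply: continuous_subspaceT => t.
apply: (@continuousD R V R (fun=> x)); first exact: cst_continuous.
by apply: (@continuousZr_tmp R V R id); exact: id.
Qed.

End Topology.

(** * Coordinates, smooth maps and open conditions on R^d and C^2 *)

Section EuclideanMaps.
Variable R : realType.

Lemma planept0 (u w : R) : planept u w 0 0 = u.
Proof. by rewrite mxE. Qed.

Lemma planept1 (u w : R) : planept u w 0 1 = w.
Proof. by rewrite mxE. Qed.

Lemma plane_eqP (x y : plane R) : x 0 0 = y 0 0 -> x 0 1 = y 0 1 -> x = y.
Proof.
move=> e0 e1; apply/rowP => -[[|[|//]] jlt].
  by move: e0; congr (x _ _ = y _ _); apply/val_inj.
by move: e1; congr (x _ _ = y _ _); apply/val_inj.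
Qed.

Lemma rational_coord d (A : set 'rV[R]_d) (j : 'I_d) :
  rational_on A (fun u => u 0 j).
Proof.
by apply: rational_lin => [k u v|]; [rewrite !mxE | exact: coord_continuous].
Qed.

Lemma rational_fst (A : set (cplane R)) j : rational_on A (fun z => z.1 0 j).
Proof.
apply: rational_lin => [k u v|z]; first by rewrite /= !mxE.
apply: (@continuous_comp _ _ _ fst (fun x : plane R => x 0 j)).
  exact: cvg_fst.
exact: coord_continuous.
Qed.

Lemma rational_snd (A : set (cplane R)) j : rational_on A (fun z => z.2 0 j).
Proof.
apply: rational_lin => [k u v|z]; first by rewrite /= !mxE.
apply: (@continuous_comp _ _ _ snd (fun x : plane R => x 0 j)).
  exact: cvg_snd.
exact: coord_continuous.
Qed.

Lemma rational_id (A : set R) : rational_on A id.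
Proof. by apply: rational_lin => // x; exact: id. Qed.

Variable V : normedModType R.

Lemma smooth_row d (A : set V) (F : 'I_d -> V -> R) : open A ->
  (forall j, rational_on A (F j)) -> smooth_on A (fun x => \row_j F j x).
Proof.
move=> Ao RF; rewrite (_ : (fun x => _) = lin_comb (fun j => delta_mx 0 j) F).
  exact: smooth_lin_comb.
apply/funext => x; rewrite /lin_comb [LHS]row_sum_delta.
by apply: eq_bigr => j _; rewrite mxE.
Qed.

Lemma smooth_cplane (A : set V) (F G : 'I_2 -> V -> R) : open A ->
  (forall j, rational_on A (F j)) -> (forall j, rational_on A (G j)) ->
  smooth_on A (fun x => (\row_j F j x, \row_j G j x) : cplane R).
Proof.
move=> Ao RF RG.
(* [lin_comb] wants one index set, so the four real directions of C^2 are listed together, those of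
   the real part first. *)
pose w (i : 'I_(2 + 2)) : cplane R := match fintype.split i with
  inl j => (delta_mx 0 j, 0) | inr j => (0, delta_mx 0 j) end.
pose H (i : 'I_(2 + 2)) := match fintype.split i with inl j => F j | inr j => G j end.
rewrite (_ : (fun x => _) = lin_comb w H).
  by apply: smooth_lin_comb => // i; rewrite /H; case: fintype.split.
have wH i x : H i x *: w i = (if fintype.split i is inl j then F j x *: delta_mx 0 j else 0,
    if fintype.split i is inr j then G j x *: delta_mx 0 j else 0).
  by rewrite /H /w; case: fintype.split => j; congr pair; rewrite scaler0.
apply/funext => x; rewrite /lin_comb (eq_bigr _ (fun i _ => wH i x)).
apply: injective_projections => /=.
  rewrite (raddf_sum fst) /=.
  rewrite big_split_ord /= [X in _ + X]big1 ?addr0; last first.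
    by move=> j _; rewrite (unsplitK (inr _ j)).
  rewrite [LHS]row_sum_delta; apply: eq_bigr => j _.
  by rewrite mxE (unsplitK (inl _ j)).
rewrite (raddf_sum snd) /=.
rewrite big_split_ord /= [X in X + _]big1 ?add0r; last first.
  by move=> j _; rewrite (unsplitK (inl _ j)).
rewrite [LHS]row_sum_delta; apply: eq_bigr => j _.
by rewrite mxE (unsplitK (inr _ j)).
Qed.

Lemma open_pos (T : topologicalType) (f : T -> R) :
  continuous f -> open [set x | 0 < f x].
Proof.
move=> fc; apply: (@open_comp _ _ f [set y | 0 < y]) => [x _|]; first exact: fc.
exact: open_gt.
Qed.

Lemma open_neq0 (T : topologicalType) (f : T -> R) :
  continuous f -> open [set x | f x <> 0].
Proof.
move=> fc; apply: (@open_comp _ _ f [set y | y <> 0]) => [x _|]; first exact: fc.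
rewrite (_ : mkset _ = ~` [set 0]) //; apply: closed_openC; exact: closed_eq.
Qed.

Lemma open_forall_le (T : topologicalType) m (A : nat -> set T) :
  (forall k, open (A k)) -> open [set x | forall k, (1 <= k <= m)%N -> A k x].
Proof.
move=> Ao; elim: m => [|m IHm].
  rewrite (_ : mkset _ = setT); first exact: openT.
  by apply/seteqP; split=> // x _ k /andP[k1 k0]; lia.
rewrite (_ : mkset _ =
    [set x | forall k, (1 <= k <= m)%N -> A k x] `&` A m.+1); first exact: openI.
apply/seteqP; split=> x /=.
  by move=> h; split=> [k km|]; apply: h; lia.
move=> [h hm] k /andP[k1]; rewrite leq_eqVlt => /predU1P[-> //|km].
by apply: h; rewrite k1.
Qed.

Lemma continuous_planept (T : topologicalType) (f g : T -> R) (x : T) :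
  {for x, continuous f} -> {for x, continuous g} ->
  {for x, continuous (fun y => planept (f y) (g y))}.
Proof.
move=> cf cg.
rewrite (_ : (fun y => _) = (fun y => f y *: planept 1 0 + g y *: planept 0 1)).
  by apply: continuousD; exact: continuousZr_tmp.
by apply/funext => y; apply: plane_eqP; rewrite !mxE /=; ring.
Qed.

Lemma continuous_pairing (T U W : topologicalType) (f : T -> U) (g : T -> W) (x : T) :
  {for x, continuous f} -> {for x, continuous g} ->
  {for x, continuous (fun y => (f y, g y))}.
Proof. by move=> cf cg; apply: (@cvg_pair _ _ _ (nbhs x) (nbhs (f x)) (nbhs (g x))). Qed.

End EuclideanMaps.

Lemma submanifold_open_cplane (R : realType) (S : set (cplane R)) : open S -> submanifold 4 S.
Proof.
move=> So p Sp.
pose g (u : 'rV[R]_(2 + 2)) : cplane R :=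
  (\row_j u 0 (@lshift 2 2 j), \row_j u 0 (@rshift 2 2 j)).
pose h (z : cplane R) : 'rV[R]_(2 + 2) := \row_j row_mx z.1 z.2 0 j.
have gh z : g (h z) = z.
  case: z => x y; rewrite /g /h /=; congr pair; apply/rowP => j.
    by rewrite !mxE (unsplitK (inl _ j)).
  by rewrite !mxE (unsplitK (inr _ j)).
have hg u : h (g u) = u.
  apply/rowP => j; rewrite /h /g !mxE; case: (split_ordP j) => k ->.
    by rewrite mxE.
  by rewrite mxE.
have gsm A : open A -> smooth_on A g.
  by move=> Ao; apply: smooth_cplane => // j; exact: rational_coord.
have hsm A : open A -> smooth_on A h.
  move=> Ao; apply: smooth_row => // j; case: (split_ordP j) => k ->.
    suff -> : (fun z : cplane R => row_mx z.1 z.2 0 (lshift 2 k)) =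
        (fun z => z.1 0 k) by exact: rational_fst.
    by apply/funext => z; rewrite row_mxEl.
  suff -> : (fun z : cplane R => row_mx z.1 z.2 0 (rshift 2 k)) =
      (fun z => z.2 0 k) by exact: rational_snd.
  by apply/funext => z; rewrite row_mxEr.
have go : open (g @^-1` S).
  apply: open_comp => // u _.
  by have [] := gsm setT openT [::] u I.
exists S, (g @^-1` S), g, h; split=> //; split=> //.
- exact: gsm.
- exact: hsm.
- rewrite setIid; apply/seteqP; split=> [_ [u Su <-] //|z Sz].
  by exists (h z); rewrite /= gh.
Qed.

(** * The arrangement in normal form; contractibility of U *)

Section Configuration.
Variables (R : realType) (n : nat) (mu b c : nat -> R).
Implicit Types (x y v : plane R) (r t : R) (i j k : nat).

(* The real part at x + i y of the k-th normalized equation is [re_part k x],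
   the imaginary part is [im_part k y]; index 0 stands for the constant -1. *)
Definition im_part k y := mu k * y 0 0 + b k * y 0 1.
Definition re_part k x := im_part k x - c k.
Local Notation P := re_part.
Local Notation Q := im_part.

(* Imaginary and real parts of the product of one equation by the conjugate of
   the preceding one. *)
Definition cross k x y := P k.-1 x * Q k y - P k x * Q k.-1 y.
Definition dot k x y := P k.-1 x * P k x + Q k.-1 y * Q k y.

(** The excluded condition says that 0 lies on the closed segment joining the two consecutive
    values. The weak inequality covers the zeros of the equations too, so one condition expresses
    both the complement and the removal of the sails; see [in_UE]. *)
Definition in_U x y :=
  forall k, (1 <= k <= n)%N -> ~ (cross k x y = 0 /\ dot k x y <= 0).

Definition in_S i x y :=
  [/\ forall k, (1 <= k <= n)%N -> ~ (P k x = 0 /\ Q k y = 0),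
      cross i x y = 0 & dot i x y < 0].

(** The coefficient [mu] lets the constant -1 share the formula of the lines, so that the first sail
    fits the general computations. Monotonicity of [b] is weak because lines may be parallel. *)
Record configuration : Prop := Configuration {
  conf_mu0 : mu 0 = 0; conf_b0 : b 0 = 0; conf_c0 : c 0 = 1;
  conf_mu : forall k, (0 < k)%N -> mu k = 1;
  conf_pos : forall k, (1 <= k <= n)%N -> 0 < c k;
  conf_c : forall j k, (1 <= j)%N -> (j < k)%N -> (k <= n)%N -> c k < c j;
  conf_b : forall j k, (1 <= j)%N -> (j < k)%N -> (k <= n)%N -> b k <= b j }.
Hypothesis conf : configuration.

Lemma re_part0 x : P 0 x = -1.
Proof. by rewrite /P /Q !(conf_mu0, conf_b0, conf_c0) // !mul0r addr0 sub0r. Qed.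

Lemma im_part0 y : Q 0 y = 0.
Proof. by rewrite /Q !(conf_mu0, conf_b0) // !mul0r addr0. Qed.

Lemma re_partE k x : (0 < k)%N -> P k x = x 0 0 + b k * x 0 1 - c k.
Proof. by move=> k0; rewrite /P /Q conf_mu // mul1r. Qed.

Lemma im_partE k y : (0 < k)%N -> Q k y = y 0 0 + b k * y 0 1.
Proof. by move=> k0; rewrite /Q conf_mu // mul1r. Qed.

Lemma re_part_shift k x t y : P k (x + t *: y) = P k x + t * Q k y.
Proof. by rewrite /P /Q !mxE; ring. Qed.

Lemma im_part_scale k t y : Q k (t *: y) = t * Q k y.
Proof. by rewrite /Q !mxE; ring. Qed.

Lemma im_part_at0 k : Q k 0 = 0.
Proof. by rewrite /Q !mxE; ring. Qed.

Lemma mu_ge0 k : 0 <= mu k.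
Proof. by case: k => [|k]; rewrite ?conf_mu0 // conf_mu. Qed.

Lemma gap_c j k : (j < k)%N -> (k <= n)%N -> 0 < c j - mu j * c k.
Proof.
case: j => [|j] jk kn; first by rewrite conf_c0 // conf_mu0 // mul0r subr0.
by rewrite conf_mu // mul1r subr_gt0; exact: conf_c.
Qed.

Lemma gap_b j k : (j < k)%N -> (k <= n)%N -> 0 <= b j - mu j * b k.
Proof.
case: j => [|j] jk kn; first by rewrite conf_b0 // conf_mu0 // mul0r subr0.
by rewrite conf_mu // mul1r subr_ge0; exact: conf_b.
Qed.

Lemma c_anti j k : (1 <= j)%N -> (j <= k)%N -> (k <= n)%N -> c k <= c j.
Proof.
move=> j1; rewrite leq_eqVlt => /predU1P[-> //|jk] kn.
by apply/ltW/conf_c.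
Qed.

Lemma b_anti j k : (1 <= j)%N -> (j <= k)%N -> (k <= n)%N -> b k <= b j.
Proof.
move=> j1; rewrite leq_eqVlt => /predU1P[-> //|jk] kn.
exact: conf_b.
Qed.

(** * Signs of all equations at points with a given ratio r *)

Section Ratio.
Variables (i : nat) (r : R).
Hypotheses (i1 : (1 <= i)%N) (i_n : (i <= n)%N) (r0 : 0 < r).

Lemma ratio_den_gt0 : 0 < mu i.-1 + r.
Proof. exact: ltr_wpDl (mu_ge0 _) r0. Qed.

(** The relation eliminates z_1: [A] and [B] are the combinations, with weights 1 and [r], of the
    gaps from [i.-1] and [i] to [k]. The same [B] governs real and imaginary parts, so Q_k = 0 with
    y_2 <> 0 forces B = 0 and then P_k <> 0. *)
Lemma ratio_above k : (i <= k)%N -> (k <= n)%N -> exists A B, [/\ 0 < A, 0 <= B,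
    forall x, P i.-1 x + r * P i x = 0 -> (mu i.-1 + r) * P k x = A - B * x 0 1 &
    forall y, Q i.-1 y + r * Q i y = 0 -> (mu i.-1 + r) * Q k y = - (B * y 0 1)].
Proof.
move=> ik kn.
exists (c i.-1 - mu i.-1 * c k + r * (c i - c k)),
  (b i.-1 - mu i.-1 * b k + r * (b i - b k)).
have i1k : (i.-1 < k)%N by lia.
split.
- by apply: ltr_wpDr (gap_c i1k kn); rewrite mulr_ge0 ?subr_ge0 ?c_anti ?ltW.
- by rewrite addr_ge0 ?gap_b // mulr_ge0 ?subr_ge0 ?b_anti // ltW.
- move=> x e; apply/eqP; rewrite -subr_eq0 -[X in _ == X]e; apply/eqP.
  by rewrite !(re_partE _ i1) (re_partE _ (leq_trans i1 ik)) /P /Q; ring.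
- move=> y e; apply/eqP; rewrite -subr_eq0 -[X in _ == X]e; apply/eqP.
  by rewrite !(im_partE _ i1) (im_partE _ (leq_trans i1 ik)) /Q; ring.
Qed.

(** Here [k = i.-1] is allowed, so the positivity of [A] comes from its [r]-term. In [ratio_above]
    it comes from the other term, as [k = i] is allowed there. *)
Lemma ratio_below k : (1 <= k)%N -> (k < i)%N -> exists A B, [/\ 0 < A, 0 <= B,
    forall x, P i.-1 x + r * P i x = 0 -> (mu i.-1 + r) * P k x = B * x 0 1 - A &
    forall y, Q i.-1 y + r * Q i y = 0 -> (mu i.-1 + r) * Q k y = B * y 0 1].
Proof.
move=> k1 ki; have i2 : (0 < i.-1)%N by lia.
have ki1 : (k <= i.-1)%N by lia.
exists (c k - c i.-1 + r * (c k - c i)), (b k - b i.-1 + r * (b k - b i)).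
split.
- apply: ltr_wpDl; first by rewrite subr_ge0 c_anti //; lia.
  by rewrite mulr_gt0 // subr_gt0 conf_c.
- by rewrite addr_ge0 ?mulr_ge0 ?subr_ge0 ?b_anti //; try lia; rewrite ltW.
- move=> x e; apply/eqP; rewrite -subr_eq0 -[X in _ == X]e; apply/eqP.
  by rewrite !(re_partE _ i1) !(re_partE _ i2) (re_partE _ k1) (conf_mu _ i2) //; ring.
- move=> y e; apply/eqP; rewrite -subr_eq0 -[X in _ == X]e; apply/eqP.
  by rewrite !(im_partE _ i1) !(im_partE _ i2) (im_partE _ k1) (conf_mu _ i2) //; ring.
Qed.

Lemma ratio_real y : Q i.-1 y + r * Q i y = 0 -> y 0 1 = 0 -> y = 0.
Proof.
rewrite /Q => yr y1; rewrite y1 !mulr0 !addr0 (conf_mu _ i1) // mul1r -mulrDl in yr.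
have := ratio_den_gt0 => D0.
move/eqP: yr; rewrite mulf_eq0 gt_eqF //= => /eqP y00.
by apply: plane_eqP; rewrite mxE.
Qed.

End Ratio.

(** Up to sign, [r] is the coefficient of the orthogonal projection of (p', q') onto (p, q). The
    residual is a multiple of the cross term, hence 0. *)
Lemma negative_ratio (p' q' p q : R) :
  p' * q - p * q' = 0 -> p' * p + q' * q < 0 ->
  exists2 r, 0 < r & p' + r * p = 0 /\ q' + r * q = 0.
Proof.
move=> cr dt.
have s0 : 0 < p ^+ 2 + q ^+ 2.
  rewrite lt_neqAle addr_ge0 ?sqr_ge0 // andbT eq_sym; apply/eqP => /eqP.
  rewrite paddr_eq0 ?sqr_ge0 // !sqrf_eq0 => /andP[/eqP p0 /eqP q0].
  by move: dt; rewrite p0 q0 !mulr0 addr0 ltxx.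
exists (- (p' * p + q' * q) / (p ^+ 2 + q ^+ 2)); first by rewrite divr_gt0 ?oppr_gt0.
split.
  have -> : p' + - (p' * p + q' * q) / (p ^+ 2 + q ^+ 2) * p =
      q * (p' * q - p * q') / (p ^+ 2 + q ^+ 2) by field; rewrite gt_eqF.
  by rewrite cr mulr0 mul0r.
have -> : q' + - (p' * p + q' * q) / (p ^+ 2 + q ^+ 2) * q =
    - p * (p' * q - p * q') / (p ^+ 2 + q ^+ 2) by field; rewrite gt_eqF.
by rewrite cr mulr0 mul0r.
Qed.

Lemma in_S_ratio i x y : in_S i x y ->
  exists2 r, 0 < r & P i.-1 x + r * P i x = 0 /\ Q i.-1 y + r * Q i y = 0.
Proof. by case=> _; exact: negative_ratio. Qed.

Lemma ratio_in_S i x y r : (1 <= i <= n)%N -> 0 < r ->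
  P i.-1 x + r * P i x = 0 -> Q i.-1 y + r * Q i y = 0 ->
  (forall k, (1 <= k <= n)%N -> ~ (P k x = 0 /\ Q k y = 0)) -> in_S i x y.
Proof.
move=> i1n r0 eP eQ M.
have Pi : P i.-1 x = - r * P i x by move: eP; lra.
have Qi : Q i.-1 y = - r * Q i y by move: eQ; lra.
split=> //; first by rewrite /cross Pi Qi; ring.
rewrite /dot Pi Qi -!mulrA -mulrDr -!expr2 mulNr oppr_lt0 mulr_gt0 //.
rewrite lt_neqAle addr_ge0 ?sqr_ge0 // andbT eq_sym; apply/eqP => /eqP.
rewrite paddr_eq0 ?sqr_ge0 // !sqrf_eq0 => /andP[/eqP p0 /eqP q0].
exact: (M i).
Qed.

(* If Q_k vanishes although y does not, then H_k is parallel to y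
   and the sign of P_k only depends on the order of the c_k. *)
Lemma ratio_nonvanishing i r x y k : (1 <= i <= n)%N -> (1 <= k <= n)%N ->
  0 < r -> P i.-1 x + r * P i x = 0 -> Q i.-1 y + r * Q i y = 0 ->
  y 0 1 != 0 -> ~ (P k x = 0 /\ Q k y = 0).
Proof.
move=> /andP[i1 i_n] /andP[k1 kn] r0 eP eQ y1 [Pk Qk].
have [ik|ki] := leqP i k.
  have [A [B [A0 B0 /(_ x eP) + /(_ y eQ)]]] := ratio_above i1 i_n r0 ik kn.
  rewrite Pk Qk !mulr0 => /esym eA /eqP; rewrite eq_sym oppr_eq0 mulf_eq0.
  by rewrite (negPf y1) orbF => /eqP B00; move: eA A0; rewrite B00; lra.
have [A [B [A0 B0 /(_ x eP) + /(_ y eQ)]]] := ratio_below i1 i_n r0 k1 ki.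
rewrite Pk Qk !mulr0 => /esym eA /eqP; rewrite eq_sym mulf_eq0.
by rewrite (negPf y1) orbF => /eqP B00; move: eA A0; rewrite B00; lra.
Qed.

(** Since [i < j], both [j.-1] and [j] are at least [i], so the equation of the second sail can be
    written through [ratio_above]. If y_2 <> 0, its imaginary part gives B + s B' = 0, so B = B' =
    0; its real part then reads A + s A' = 0 with A, A' > 0. *)
Lemma in_S_meet_lt i j x y : (1 <= i)%N -> (i < j)%N -> (j <= n)%N ->
  in_S i x y -> in_S j x y -> y = 0.
Proof.
move=> i1 ij jn /in_S_ratio[r r0 [eP eQ]] /in_S_ratio[s s0 [fP fQ]].
apply: (ratio_real i1 r0 eQ).
apply/eqP/negPn/negP => y1.
have i_n : (i <= n)%N by lia.
have D0 := ratio_den_gt0 i r0.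
have [||A [B [A0 B0 /(_ x eP) PA /(_ y eQ) QA]]] :=
  @ratio_above i r i1 i_n r0 j.-1; [lia..|].
have [||A' [B' [A0' B0' /(_ x eP) PA' /(_ y eQ) QA']]] :=
  @ratio_above i r i1 i_n r0 j; [lia..|].
have eBy : (B + s * B') * y 0 1 = 0.
  transitivity (- ((mu i.-1 + r) * Q j.-1 y + s * ((mu i.-1 + r) * Q j y))).
    by rewrite QA QA'; ring.
  by rewrite mulrCA -mulrDr fQ mulr0 oppr0.
have eAx : A - B * x 0 1 + s * (A' - B' * x 0 1) = 0.
  by rewrite -PA -PA' mulrCA -mulrDr fP mulr0.
have sA : 0 < s * A' by exact: mulr_gt0.
have /eqP : B + s * B' = 0.
  by move/eqP: eBy; rewrite mulf_eq0 (negPf y1) orbF => /eqP.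
rewrite paddr_eq0 ?(mulr_ge0 (ltW s0)) // mulf_eq0 (gt_eqF s0) /=.
by move=> /andP[/eqP B00 /eqP B00']; move: eAx; rewrite B00 B00'; lra.
Qed.

Lemma in_S_meet i j x y : (1 <= i <= n)%N -> (1 <= j <= n)%N -> i <> j ->
  in_S i x y -> in_S j x y -> y = 0.
Proof.
move=> /andP[i1 i_n] /andP[j1 jn] ij Si Sj.
have [lt|gt|//] := ltngtP i j; first exact: (in_S_meet_lt i1 lt jn Si Sj).
exact: (in_S_meet_lt j1 gt i_n Sj Si).
Qed.

(** The shear preserves [cross]. If [cross] is 0, the old values are positive multiples of each
    other ([negative_ratio] with one vector negated), and the shear keeps that ratio; [dot] could
    only drop to 0 if the values themselves vanished. *)
Lemma in_U_translate x y t : in_U x y -> in_U (x + t *: y) y.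
Proof.
move=> xyU k k1n; rewrite /cross /dot !re_part_shift => -[cr dt].
have cr0 : cross k x y = 0 by rewrite -cr /cross; ring.
have dt0 : 0 < dot k x y by rewrite ltNge; apply/negP => dt0; exact: (xyU k).
set p' := P k.-1 x in cr dt cr0 dt0 *; set p := P k x in cr dt cr0 dt0 *.
have [] := @negative_ratio (- p') (- Q k.-1 y) p (Q k y).
- by move: cr0; rewrite /cross -/p -/p'; lra.
- by move: dt0; rewrite /dot -/p -/p'; lra.
move=> r r0 [ep eq].
have ep' : p' = r * p by lra.
have eq' : Q k.-1 y = r * Q k y by lra.
suff : 0 < (p + t * Q k y) ^+ 2 + Q k y ^+ 2.
  move: dt; rewrite ep' eq'.
  have -> : (r * p + t * (r * Q k y)) * (p + t * Q k y) + r * Q k y * Q k y =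
    r * ((p + t * Q k y) ^+ 2 + Q k y ^+ 2) by ring.
  by rewrite pmulr_rle0 // => /le_lt_trans h /h; rewrite ltxx.
rewrite lt_neqAle addr_ge0 ?sqr_ge0 // andbT eq_sym; apply/eqP => /eqP.
rewrite paddr_eq0 ?sqr_ge0 // !sqrf_eq0 => /andP[/eqP p0 /eqP q0].
move: p0 dt0; rewrite /dot -/p' -/p q0 !mulr0 !addr0 => ->.
by rewrite mulr0 ltxx.
Qed.

Lemma re_part_prev_lt0 x k : (forall k, (1 <= k <= n)%N -> P k x < 0) ->
  (1 <= k <= n)%N -> P k.-1 x < 0.
Proof.
by case: k => [|[|k]] // nP /andP[_ kn]; [rewrite re_part0; lra | apply: nP; lia].
Qed.

(** Multiplied by p' p, the dot product is a sum of squares minus a multiple of the cross term. The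
    lemma is also applied with the real and imaginary parts exchanged. *)
Lemma dot_gt0_same_sign (p' q' p q : R) :
  p' * q - p * q' = 0 -> 0 < p' * p -> 0 < p' * p + q' * q.
Proof.
move=> cr pp.
have : 0 < (p' * p) * (p' * p + q' * q).
  have -> : (p' * p) * (p' * p + q' * q) =
    (p' * p) ^+ 2 + (p' * q) ^+ 2 - (p' * q) * (p' * q - p * q') by ring.
  by rewrite cr mulr0 subr0 ltr_pwDl ?sqr_ge0 // exprn_gt0.
by rewrite pmulr_rgt0.
Qed.

(** All values, including alpha_0 = -1, lie in the open left half-plane, which is convex and misses
    0. No condition on y is involved. *)
Lemma in_U_neg x y : (forall k, (1 <= k <= n)%N -> P k x < 0) -> in_U x y.
Proof.
move=> nP k k1n [cr dt].
have pp : 0 < P k.-1 x * P k x.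
  by rewrite (nmulr_rgt0 _ (re_part_prev_lt0 nP k1n)); exact: nP.
by have := dot_gt0_same_sign cr pp; rewrite ltNge => /negP; exact.
Qed.

(** Only the sign of [s] matters: it chooses a side of the real axis. The first segment is treated
    apart because alpha_0 = -1 lies on that axis; it meets the axis only in -1. *)
Lemma in_U_side (s : R) x y : (forall k, (1 <= k <= n)%N -> 0 < s * Q k y) ->
  in_U x y.
Proof.
move=> sQ [|[|k]] // k1n [cr dt].
  move: cr; rewrite /cross /= re_part0 im_part0 mulr0 subr0 mulN1r => /eqP.
  by rewrite oppr_eq0 => /eqP Q1; have := sQ 1%N k1n; rewrite Q1 mulr0 ltxx.
have Qk := sQ _ k1n; have {sQ}Qk' : 0 < s * Q k.+1 y by apply: sQ; lia.
have qq : 0 < Q k.+1 y * Q k.+2 y.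
  have : 0 < s ^+ 2 * (Q k.+1 y * Q k.+2 y).
    by have -> : s ^+ 2 * (Q k.+1 y * Q k.+2 y) = (s * Q k.+1 y) * (s * Q k.+2 y);
      [ring | exact: mulr_gt0].
  rewrite pmulr_rgt0 // lt_neqAle sqr_ge0 andbT eq_sym sqrf_eq0.
  by apply: contraTneq Qk => ->; rewrite mul0r ltxx.
suff : 0 < dot k.+2 x y by rewrite ltNge dt.
rewrite /dot addrC; apply: dot_gt0_same_sign qq.
by move: cr; rewrite /cross /=; lra.
Qed.

(** For real values, a segment missing 0 allows no sign change, and the sequence starts at P_0 =
    -1. *)
Lemma in_U_real x k : in_U x 0 -> (1 <= k <= n)%N -> P k x < 0.
Proof.
move=> xU; elim: k => [|k IHk] // k1n.
have Pk : P k x < 0.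
  by case: k IHk k1n => [|k] IHk k1n; [rewrite re_part0; lra | apply: IHk; lia].
rewrite ltNge; apply/negP => Pk1; apply: (xU _ k1n).
rewrite /cross /dot !im_part_at0 !mulr0 subrr addr0; split=> //=.
by rewrite nmulr_rle0.
Qed.

(** * Descent of [U] to the half-plane x_2 <= 0 *)

Definition bound_b := 1 + \sum_(1 <= k < n.+1) `|b k|.
Local Notation K := bound_b.

(** Strictness is used twice: |y_1| >= K |y_2| with y <> 0 gives every Q_k the sign of y_1, and K +
    b_k > 0 makes every P_k decrease along -(K, 1). *)
Lemma bound_b_gt k : (1 <= k <= n)%N -> `|b k| < K.
Proof.
move=> /andP[k1 kn].
rewrite /bound_b (big_cat_nat _ (n := k)) //=; last by lia.
rewrite (@big_ltn _ _ _ k) //.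
have h1 : 0 <= \sum_(1 <= j < k) `|b j| by apply: sumr_ge0.
have h2 : 0 <= \sum_(k.+1 <= j < n.+1) `|b j| by apply: sumr_ge0.
lra.
Qed.

Lemma bound_b_gt0 : 0 < K.
Proof. by rewrite /bound_b ltr_pwDl ?ltr01 // sumr_ge0. Qed.

(** A continuous cutoff for the chamber of the origin: it vanishes outside, where the descent must
    follow y exactly, and is positive inside, where it keeps the denominator of [slope] alive over y
    = 0. *)
Definition all_neg x := \prod_(1 <= k < n.+1) Num.max 0 (- P k x).

Lemma all_neg_ge0 x : 0 <= all_neg x.
Proof. by apply: prodr_ge0 => k _; rewrite le_max lexx. Qed.

Lemma all_neg_gt0P x :
  0 < all_neg x <-> forall k, (1 <= k <= n)%N -> P k x < 0.
Proof.
split=> [+ k k1n | nP].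
  rewrite lt_neqAle eq_sym => /andP[+ _].
  rewrite prodf_seq_neq0 => /allP/(_ k).
  rewrite mem_index_iota ltnS => /(_ k1n) /=.
  by apply: contra_neqT; rewrite -leNgt => Pk; rewrite max_l // oppr_le0.
rewrite /all_neg big_nat_cond; apply: prodr_gt0 => k.
by rewrite andbT ltnS => /nP Pk; rewrite lt_max oppr_gt0 Pk orbT.
Qed.

(** For |y_1| < K |y_2| this is K^2 y_2^2, and K^2 y_1 y_2 divided by it is y_1 / y_2, the slope of
    y. The term y_1^2 keeps it positive when only y_2 vanishes. *)
Definition weight y := Num.max (y 0 0 ^+ 2) (K ^+ 2 * y 0 1 ^+ 2).

(* The point x moves down to the half-plane x_2 <= 0. The direction is y where
   the fibre of U over y is cut by lines parallel to y (which requires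
   |y_1| < K |y_2|), and (K, 1), along which all equations decrease, over
   y = 0. The weights make the direction continuous. *)
Definition slope x y :=
  (K ^+ 2 * y 0 0 * y 0 1 + K * all_neg x) / (weight y + all_neg x).
Definition descent x y := x - Num.max 0 (x 0 1) *: planept (slope x y) 1.

Lemma weight_ge0 y : 0 <= weight y.
Proof. by rewrite le_max sqr_ge0. Qed.

Lemma weight_gt0 y : y <> 0 -> 0 < weight y.
Proof.
move=> y0; rewrite lt_max !lt_neqAle eq_sym sqr_ge0 andbT sqrf_eq0.
rewrite mulr_ge0 ?sqr_ge0 // andbT [0 == _]eq_sym mulf_eq0 !sqrf_eq0.
rewrite (gt_eqF bound_b_gt0) /= -negb_and.
by apply/negP => /andP[/eqP y00 /eqP y01]; apply: y0; apply: plane_eqP; rewrite mxE.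
Qed.

(** Where [weight] vanishes, y = 0, and [U] then forces x into the chamber of the origin, where
    [all_neg] is positive. *)
Lemma descent_den_gt0 x y : in_U x y -> 0 < weight y + all_neg x.
Proof.
move=> xyU; have [y0|/eqP y0] := eqVneq y 0; last first.
  by rewrite ltr_pwDl ?all_neg_ge0 // weight_gt0.
rewrite ltr_wpDl ?weight_ge0 //; apply/all_neg_gt0P => k.
by apply: in_U_real; rewrite -y0.
Qed.

Lemma re_part_down k x (u : R) : (1 <= k <= n)%N -> 0 <= u ->
  P k (x - u *: planept K 1) <= P k x.
Proof.
move=> k1n u0; rewrite -scaleNr re_part_shift gerDl mulNr oppr_le0 mulr_ge0 //.
rewrite im_partE ?planept0 ?planept1 ?mulr1; last by lia.
by have := bound_b_gt k1n; rewrite ltr_norml => /andP[]; lra.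
Qed.

Lemma in_U_steep x y : y <> 0 -> K * `|y 0 1| <= `|y 0 0| -> in_U x y.
Proof.
move=> y0 Ky; apply: (@in_U_side (y 0 0)) => k k1n.
have y00 : y 0 0 != 0.
  apply: contra_notN y0 => /eqP y00; apply: plane_eqP; rewrite mxE //.
  apply/eqP; rewrite -normr_le0 -(pmulr_rle0 _ bound_b_gt0).
  by rewrite (le_trans Ky) // y00 normr0.
rewrite im_partE ?mulrDr; last by lia.
rewrite -expr2 -real_normK ?num_real // -subr_gt0.
have by1 : `|b k * y 0 1| < `|y 0 0|.
  have [->|y1] := eqVneq (y 0 1) 0; first by rewrite mulr0 normr0 normr_gt0.
  by rewrite normrM (lt_le_trans _ Ky) // ltr_pM2r ?normr_gt0 ?bound_b_gt.
have : `|y 0 0 * (b k * y 0 1)| < `|y 0 0| ^+ 2.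
  by rewrite normrM expr2 ltr_pM2l // normr_gt0.
by rewrite ltr_norml => /andP[]; lra.
Qed.

(** Three regimes: over y = 0 the direction is exactly (K, 1) and all P_k stay negative; for |y_1|
    >= K |y_2| membership does not depend on x; in between, the shear along y does the work. *)
Lemma in_U_descent x y (u : R) : in_U x y -> 0 <= u ->
  in_U (x - u *: planept (slope x y) 1) y.
Proof.
move=> xyU u0; have den0 := descent_den_gt0 xyU.
have [y0|/eqP y0] := eqVneq y 0.
  rewrite /slope y0 mxE mulr0 mul0r add0r /weight !mxE !expr0n mulr0 maxxx add0r.
  have n0 : 0 < all_neg x by apply/all_neg_gt0P => k; apply: in_U_real; rewrite -y0.
  rewrite mulfK ?gt_eqF //; apply: in_U_neg => k k1n.
  by apply: le_lt_trans (re_part_down x k1n u0) _; exact: (all_neg_gt0P x).1.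
have [Ky|Ky] := leP (K * `|y 0 1|) `|y 0 0|; first exact: in_U_steep.
have y1 : y 0 1 != 0.
  by apply: contraTneq Ky => ->; rewrite normr0 mulr0 -leNgt.
have wE : weight y = K ^+ 2 * y 0 1 ^+ 2.
  rewrite /weight max_r // -exprMn -(real_normK (num_real (y 0 0))).
  rewrite -(real_normK (num_real (K * y 0 1))) lerXn2r ?nnegrE //.
  by rewrite normrM (gtr0_norm bound_b_gt0) ltW.
(* The displacement splits into a nonnegative multiple of -(K, 1), nonzero only if x is in the
   chamber of the origin, and a multiple of y, which [in_U_translate] absorbs. *)
have -> : x - u *: planept (slope x y) 1 =
    x - (u * all_neg x / (weight y + all_neg x)) *: planept K 1 +
    (- (u * weight y / (weight y + all_neg x) / y 0 1)) *: y.
  apply: plane_eqP; rewrite !mxE /= /slope.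
    by rewrite wE; field; rewrite exprMn -wE y1 gt_eqF.
  by field; rewrite y1 gt_eqF.
apply: in_U_translate.
have [n0|] := ltP 0 (all_neg x).
  apply: in_U_neg => k k1n; apply: (@le_lt_trans _ _ (P k x)).
    by apply: re_part_down => //; apply: divr_ge0 (ltW den0); apply: mulr_ge0 (ltW n0).
  exact: (all_neg_gt0P x).1.
move=> n0; have -> : all_neg x = 0 by apply/eqP; rewrite eq_le n0 all_neg_ge0.
by rewrite mulr0 mul0r scale0r subr0.
Qed.

Lemma descent_low x y : descent x y 0 1 <= 0.
Proof. by rewrite /descent !mxE /= mulr1 subr_le0 le_max lexx orbT. Qed.

Lemma in_U_descent_segment x y t : in_U x y -> 0 <= t ->
  in_U (x + t *: (descent x y - x)) y.
Proof.
move=> xyU t0; rewrite /descent addrAC subrr add0r scalerN scalerA.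
by apply: in_U_descent => //; rewrite mulr_ge0 // le_max lexx.
Qed.

(** * The fibres of [U] over points with x_2 <= 0 *)

Lemma re_part_gap x j k : x 0 1 <= 0 -> (1 <= j)%N -> (j < k)%N ->
  (k <= n)%N -> c j - c k <= P k x - P j x.
Proof.
move=> x1 j1 jk kn; rewrite !re_partE //; last by lia.
suff : 0 <= (b k - b j) * x 0 1 by lra.
by rewrite mulr_le0 // subr_le0; exact: conf_b.
Qed.

Lemma re_part_le x j k : x 0 1 <= 0 -> (1 <= j)%N -> (j <= k)%N ->
  (k <= n)%N -> P j x <= P k x.
Proof.
move=> x1 j1; rewrite leq_eqVlt => /predU1P[-> //|jk] kn.
have := re_part_gap x1 j1 jk kn; have := conf_c conf j1 jk kn; lra.
Qed.

(* For x_2 <= 0 the values P_1 < P_2 < ... increase, and the fibre of U over x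
   is the complement of the line pivot = 0 unless all of them are negative:
   [blend] interpolates between the b_k according to the zero of P. *)
Definition blend x := b 1 + \sum_(1 <= j < n)
  clamp (- P j x / Num.max (c j - c j.+1) (P j.+1 x - P j x)) * (b j.+1 - b j).
Definition pivot x y := y 0 0 + blend x * y 0 1.

Lemma blend_first x : x 0 1 <= 0 -> (1 <= n)%N -> 0 <= P 1 x -> blend x = b 1.
Proof.
move=> x1 n1 P1; rewrite /blend big_nat big1 ?addr0 // => j /andP[j1 jn].
rewrite clamp0 ?mul0r // pmulr_lle0.
  by rewrite oppr_le0 (le_trans P1) // re_part_le // ltnW.
by rewrite invr_gt0 lt_max subr_gt0 conf_c.
Qed.

(** The clamped weights are 1 for j < k and 0 for j > k, so the sum telescopes to b_k plus one
    fractional term. By [re_part_gap] the maximum in the denominators is inactive for x_2 <= 0;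
    elsewhere it keeps them positive, so that [blend] is continuous on the whole plane. *)
Lemma blend_between x k : x 0 1 <= 0 -> (1 <= k)%N -> (k < n)%N ->
  P k x <= 0 -> 0 <= P k.+1 x ->
  blend x = b k - P k x / (P k.+1 x - P k x) * (b k.+1 - b k).
Proof.
move=> x1 k1 kn Pk Pk1.
have dP j : (1 <= j)%N -> (j < n)%N ->
    Num.max (c j - c j.+1) (P j.+1 x - P j x) = P j.+1 x - P j x /\
    0 < P j.+1 x - P j x.
  move=> j1 jn; have h := re_part_gap x1 j1 (ltnSn j) jn.
  split; first by rewrite max_r.
  by apply: lt_le_trans h; rewrite subr_gt0 conf_c.
rewrite /blend (big_cat_nat _ (n := k)) //=; last exact: ltnW.
rewrite (@big_ltn _ _ _ k) //.
rewrite [X in b 1 + (X + _)](_ : _ = b k - b 1); last first.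
  rewrite -(telescope_sumr b k1). apply: eq_big_nat => j /andP[j1 jk].
  rewrite clamp1 ?mul1r //; have [|-> dP0] := dP j j1; first lia.
  rewrite ler_pdivlMr // mul1r lerBlDr addrC subrr.
  by apply: le_trans Pk; apply: re_part_le => //; lia.
rewrite [X in _ + (_ + (_ + X))](_ : _ = 0); last first.
  rewrite big_nat big1 // => j /andP[kj jn].
  rewrite clamp0 ?mul0r //; have [||-> dP0] := dP j; [lia..|].
  rewrite pmulr_lle0 ?invr_gt0 // oppr_le0 (le_trans Pk1) //.
  by apply: re_part_le => //; lia.
have [-> dP0] := dP k k1 kn.
have -> : clamp (- P k x / (P k.+1 x - P k x)) = - P k x / (P k.+1 x - P k x).
  rewrite /clamp min_r; last by rewrite ler_pdivrMr // mul1r; lra.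
  by rewrite max_r // divr_ge0 ?oppr_ge0 // ltW.
by rewrite mulNr; lra.
Qed.

Lemma pivot_first x y : x 0 1 <= 0 -> (1 <= n)%N -> 0 <= P 1 x ->
  pivot x y = Q 1 y.
Proof. by move=> x1 n1 P1; rewrite /pivot blend_first // im_partE. Qed.

(** The value of [pivot] is the height at which the segment from alpha_k to alpha_(k+1) crosses the
    imaginary axis. It is 0 exactly when these values are collinear with 0. *)
Lemma pivot_between x y k : x 0 1 <= 0 -> (1 <= k)%N -> (k < n)%N ->
  P k x <= 0 -> 0 <= P k.+1 x ->
  pivot x y * (P k.+1 x - P k x) = - cross k.+1 x y.
Proof.
move=> x1 k1 kn Pk Pk1; rewrite /pivot (blend_between x1 k1) // /cross /= !im_partE //.
have : 0 < P k.+1 x - P k x.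
  apply: lt_le_trans (re_part_gap x1 k1 (ltnSn k) kn).
  by rewrite subr_gt0 conf_c.
by move=> dP0; field; rewrite gt_eqF.
Qed.

Lemma in_U_pivot x y : x 0 1 <= 0 -> in_U x y -> ~ 0 < all_neg x ->
  pivot x y <> 0.
Proof.
move=> x1 xyU nneg piv0.
have [k] : exists k, (k <= n)%N && (0 <= P k x).
  apply: contra_notP nneg => nex; apply/all_neg_gt0P => k /andP[k1 kn].
  by rewrite ltNge; apply/negP => Pk; apply: nex; exists k; rewrite kn.
(* At the least k with P_k >= 0 the values pass from negative to nonnegative real part; k = 0 is
   impossible since P_0 = -1. *)
move=> kP; have {k kP}/ex_minnP[k /andP[kn Pk] kmin] : exists k, (k <= n)%N && (0 <= P k x).
  by exists k.
case: k kn Pk kmin => [|[|k]] kn Pk kmin; first by move: Pk; rewrite re_part0; lra.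
  apply: (xyU 1%N) => //; rewrite /cross /dot /= re_part0 im_part0.
  by rewrite -(pivot_first y x1) // piv0; split; lra.
have Pk1 : P k.+1 x < 0.
  rewrite ltNge; apply/negP => Pk1; have := kmin k.+1.
  by rewrite Pk1 (ltnW kn) ltnn => /(_ isT).
have /eqP := pivot_between y x1 (ltn0Sn k) kn (ltW Pk1) Pk.
rewrite piv0 mul0r eq_sym oppr_eq0 => /eqP cr.
apply: (xyU k.+2) => //; split=> //; rewrite leNgt; apply/negP => dt.
have := @negative_ratio (- P k.+1 x) (- Q k.+1 y) (P k.+2 x) (Q k.+2 y).
case; [by move: cr; rewrite /cross /=; lra|by move: dt; rewrite /dot /=; lra|].
by move=> r r0 [+ _]; have := mulr_ge0 (ltW r0) Pk; lra.
Qed.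

(** A segment through 0 cannot have endpoints with real parts of the same strict sign. As the P_k
    increase, it is the segment described by [pivot_first] or [pivot_between], whose cross term is a
    nonzero multiple of [pivot]. *)
Lemma pivot_in_U x y : x 0 1 <= 0 -> pivot x y <> 0 -> in_U x y.
Proof.
move=> x1 piv0 [|[|k]] // /andP[_ kn] [cr dt].
  move: cr dt; rewrite /cross /dot /= re_part0 im_part0 => cr dt.
  by apply: piv0; rewrite pivot_first //; lra.
have dP : P k.+1 x < P k.+2 x.
  have := re_part_gap x1 (ltn0Sn k) (ltnSn k.+1) kn.
  by have := conf_c conf (ltn0Sn k) (ltnSn k.+1) kn; lra.
have [Pk|Pk] := leP (P k.+1 x) 0; last first.
  have pp : 0 < P k.+1 x * P k.+2 x by rewrite mulr_gt0 // (lt_trans Pk).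
  by have := dot_gt0_same_sign cr pp; rewrite ltNge => /negP; exact.
have [Pk1|Pk1] := leP 0 (P k.+2 x); last first.
  have pp : 0 < P k.+1 x * P k.+2 x by rewrite nmulr_rgt0 // (lt_trans dP).
  by have := dot_gt0_same_sign cr pp; rewrite ltNge => /negP; exact.
have /eqP := pivot_between y x1 (ltn0Sn k) kn Pk Pk1.
by rewrite cr oppr0 mulf_eq0 subr_eq0 (gt_eqF dP) orbF => /eqP.
Qed.

(** * Regularity of these constructions and the contraction of [U] *)

Lemma rational_re_part A k : rational_on A (fun z : cplane R => P k z.1).
Proof.
rewrite /P /Q; apply: rational_add; last exact: rational_cst.
by apply: rational_add; (apply: rational_mul; [exact: rational_cst | exact: rational_fst]).
Qed.

Lemma rational_im_part A k : rational_on A (fun z : cplane R => Q k z.2).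
Proof.
rewrite /Q.
by apply: rational_add; (apply: rational_mul; [exact: rational_cst | exact: rational_snd]).
Qed.

Lemma rational_cross A k : rational_on A (fun z : cplane R => cross k z.1 z.2).
Proof.
rewrite /cross; apply: rational_add; last apply: rational_opp.
  by apply: rational_mul; [exact: rational_re_part | exact: rational_im_part].
by apply: rational_mul; [exact: rational_re_part | exact: rational_im_part].
Qed.

Lemma rational_dot A k : rational_on A (fun z : cplane R => dot k z.1 z.2).
Proof.
rewrite /dot; apply: rational_add.
  by apply: rational_mul; exact: rational_re_part.
by apply: rational_mul; exact: rational_im_part.
Qed.

Lemma continuous_rational (V : normedModType R) (f : V -> R) :
  rational_on setT f -> continuous f.
Proof. by move=> rf x; exact: (rational_continuous rf). Qed.

Definition nonvanishing x y :=
  forall k, (1 <= k <= n)%N -> ~ (P k x = 0 /\ Q k y = 0).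

Lemma open_nonvanishing : open [set z : cplane R | nonvanishing z.1 z.2].
Proof.
apply: (@open_forall_le _ n (fun k => [set z : cplane R | ~ (P k z.1 = 0 /\ Q k z.2 = 0)])).
move=> k; rewrite (_ : mkset _ = [set z | P k z.1 <> 0] `|` [set z | Q k z.2 <> 0]).
  apply: openU; apply: open_neq0; apply: continuous_rational.
    exact: rational_re_part.
  exact: rational_im_part.
by apply/seteqP; split=> z /=; rewrite -not_andP.
Qed.

Lemma open_in_U : open [set z : cplane R | in_U z.1 z.2].
Proof.
apply: (@open_forall_le _ n (fun k =>
  [set z : cplane R | ~ (cross k z.1 z.2 = 0 /\ dot k z.1 z.2 <= 0)])).
move=> k; rewrite (_ : mkset _ =
    [set z | cross k z.1 z.2 <> 0] `|` [set z | 0 < dot k z.1 z.2]).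
  apply: openU; [apply: open_neq0 | apply: open_pos]; apply: continuous_rational.
    exact: rational_cross.
  exact: rational_dot.
apply/seteqP; split=> z /=; rewrite not_andP => -[h|h]; [by left|right|by left|right].
  by rewrite ltNge; exact/negP.
by apply/negP; rewrite -ltNge.
Qed.

Lemma continuous_all_neg : continuous (fun z : cplane R => all_neg z.1).
Proof.
move=> z; rewrite /all_neg.
apply: cvg_big => [|k _]; first exact: mul_continuous.
apply: (@continuous_max R _ (fun=> 0) (fun z : cplane R => - P k z.1) z).
  exact: cst_continuous.
by apply: continuousN; apply: (continuous_rational (rational_re_part setT k)).
Qed.

Lemma continuous_weight : continuous (fun z : cplane R => weight z.2).
Proof.
move=> z.
apply: (@continuous_max R _ (fun z : cplane R => z.2 0 0 ^+ 2)
  (fun z => K ^+ 2 * z.2 0 1 ^+ 2) z); apply: continuous_rational.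
  by apply: rational_sqr; exact: rational_snd.
apply: rational_mul; first exact: rational_cst.
by apply: rational_sqr; exact: rational_snd.
Qed.

Lemma continuous_descent (z : cplane R) : in_U z.1 z.2 ->
  {for z, continuous (fun z : cplane R => descent z.1 z.2)}.
Proof.
move=> zU; rewrite /descent; apply: continuousB; first exact: cvg_fst.
apply: continuousZ.
  apply: (@continuous_max R _ (fun=> 0)); first exact: cst_continuous.
  exact: (continuous_rational (rational_fst setT 1)).
apply: continuous_planept; last exact: cst_continuous.
apply: continuousM; last first.
  apply: continuousV; first by rewrite gt_eqF // descent_den_gt0.
  by apply: continuousD; [exact: continuous_weight | exact: continuous_all_neg].
apply: continuousD.
  apply: continuous_rational; apply: rational_mul; last exact: rational_snd.
  by apply: rational_mul; [exact: rational_cst | exact: rational_snd].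
by apply: continuousM; [exact: cst_continuous | exact: continuous_all_neg].
Qed.

Lemma continuous_blend_weight j : (1 <= j)%N -> (j < n)%N ->
  continuous (fun z : cplane R =>
    clamp (- P j z.1 / Num.max (c j - c j.+1) (P j.+1 z.1 - P j z.1))).
Proof.
move=> j1 jn z.
have cP k : continuous (fun z : cplane R => P k z.1).
  exact: (continuous_rational (rational_re_part setT k)).
apply: (@continuous_clamp R _ (fun z : cplane R =>
  - P j z.1 / Num.max (c j - c j.+1) (P j.+1 z.1 - P j z.1)) z).
apply: continuousM; first by apply: continuousN; exact: cP.
apply: continuousV; first by rewrite gt_eqF // lt_max subr_gt0 conf_c.
apply: (@continuous_max R _ (fun=> c j - c j.+1)
  (fun z : cplane R => P j.+1 z.1 - P j z.1) z); first exact: cst_continuous.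
by apply: continuousB; exact: cP.
Qed.

Lemma continuous_pivot : continuous (fun z : cplane R => pivot z.1 z.2).
Proof.
move=> z.
apply: (@continuousD _ _ _ (fun z : cplane R => z.2 0 0)
  (fun z => blend z.1 * z.2 0 1) z).
  exact: (continuous_rational (rational_snd setT 0)).
apply: (@continuousM _ _ (fun z : cplane R => blend z.1) (fun z => z.2 0 1) z).
  2: exact: (continuous_rational (rational_snd setT 1)).
apply: (@continuousD _ _ _ (fun=> b 1) _ z); first exact: cst_continuous.
rewrite /prop_for /continuous_at big_nat; under eq_fun do rewrite big_nat.
apply: cvg_big => [|j /andP[j1 jn]]; first exact: add_continuous.
by apply: cvgM; [exact: continuous_blend_weight | exact: cvg_cst].
Qed.

Lemma re_part_convex k x x' t :
  P k (x + t *: (x' - x)) = (1 - t) * P k x + t * P k x'.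
Proof. by rewrite /P /Q !mxE; ring. Qed.

Lemma re_part_origin k : P k 0 = - c k.
Proof. by rewrite /P im_part_at0 sub0r. Qed.

Lemma contractible_in_U : contractible R [set z : cplane R | in_U z.1 z.2].
Proof.
pose f1 (z : cplane R) : cplane R := (descent z.1 z.2, z.2).
pose f2 (z : cplane R) : cplane R :=
  (descent z.1 z.2, planept (pivot (descent z.1 z.2) z.2) 0).
have cf1 z : in_U z.1 z.2 -> {for z, continuous f1}.
  move=> zU; apply: continuous_pairing; first exact: continuous_descent.
  exact: cvg_snd.
have lowU z : in_U z.1 z.2 -> in_U (descent z.1 z.2) z.2.
  move=> zU; have := in_U_descent_segment zU (@ler01 R).
  by rewrite scale1r subrKC.
set X := mkset _.
apply: (@contractible_3steps R _ _ X X id id f1 f2 (0, 0)) => //; rewrite {}/X /=.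
- by apply: in_U_neg => k k1n; rewrite re_part_origin oppr_lt0 conf_pos.
- by move=> z _; exact: id.
- by move=> z _; exact: id.
- move=> z zU; apply: continuous_pairing; first exact: continuous_descent.
  apply: (@continuous_planept R _ ((fun z : cplane R => pivot z.1 z.2) \o f1) (fun=> 0)).
    by apply: continuous_comp; [exact: cf1 | exact: continuous_pivot].
  exact: cst_continuous.
- move=> z t zU /andP[t0 _] /=; rewrite subrr scaler0 addr0.
  exact: in_U_descent_segment.
- move=> z t zU t01 /=; rewrite subrr scaler0 addr0.
  have low := descent_low z.1 z.2; set x := descent z.1 z.2 in low *.
  have [nx|nx] := pselect (0 < all_neg x).
    by apply: in_U_neg; exact/all_neg_gt0P.
  apply: pivot_in_U => //.
  (* At fixed x, [pivot] is linear in y and sends (p, 0) to p, so it stays constant along this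
     leg. *)
  suff -> : pivot x (z.2 + t *: (planept (pivot x z.2) 0 - z.2)) = pivot x z.2.
    by apply: in_U_pivot => //; exact: lowU.
  by rewrite /pivot !mxE /=; ring.
- move=> z t zU /andP[t0 t1] /=; rewrite !sub0r.
  have low := descent_low z.1 z.2; set x := descent z.1 z.2 in low *.
  have [->|tn1] := eqVneq t 1.
    rewrite !scale1r !subrr.
    by apply: in_U_neg => k k1n; rewrite re_part_origin oppr_lt0 conf_pos.
  have tlt1 : 0 < 1 - t by rewrite subr_gt0 lt_neqAle tn1.
  (* If [pivot] is nonzero, all Q_k equal (1 - t) times it and lie on one side. If it is 0, then x
     lies in the chamber of the origin, which is convex and contains 0. *)
  have [piv0|piv0] := eqVneq (pivot x z.2) 0; last first.
    apply: (@in_U_side (pivot x z.2)) => k k1n; rewrite im_partE ?mxE /=; last by lia.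
    have -> : pivot x z.2 * (pivot x z.2 + t * - pivot x z.2 + b k * (0 + t * - 0)) =
      (1 - t) * pivot x z.2 ^+ 2 by ring.
    by rewrite mulr_gt0 // lt_neqAle sqr_ge0 eq_sym sqrf_eq0 piv0.
  apply: in_U_neg => k k1n; rewrite -[- x]sub0r re_part_convex re_part_origin.
  have ck : 0 < c k by exact: conf_pos.
  have Pk : P k x < 0.
    apply: (all_neg_gt0P x).1 => //.
    apply: contrapT => nx; move/eqP: piv0; apply/negP/eqP.
    by apply: in_U_pivot => //; exact: lowU.
  have : (1 - t) * P k x < 0 by rewrite pmulr_rlt0.
  have : 0 <= t * c k by rewrite mulr_ge0 // ltW.
  lra.
Qed.

End Configuration.

(** * The sails *)

Section Sails.
Variables (R : realType) (n : nat) (mu b c : nat -> R).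
Hypothesis conf : configuration n mu b c.
Implicit Types (x y v : plane R) (z : cplane R) (u : 'rV[R]_3) (i j k : nat).
Local Notation P := (re_part mu b c).
Local Notation Q := (im_part mu b).
Local Notation in_S := (in_S n mu b c).

(* The chamber C_i containing the points of F^1 between a_i and a_(i-1). *)
Definition in_C i x := (forall k, (1 <= k < i)%N -> P k x < 0) /\
  (forall k, (i <= k <= n)%N -> 0 < P k x).

(* The sail S_i is the graph of z_1 over the coordinates
   r = - alpha_(i-1) / alpha_i and z_2. *)
Definition sail_re i (r x2 : R) := planept
  ((c i.-1 + r * c i - (b i.-1 + r * b i) * x2) * (mu i.-1 + r)^-1) x2.
Definition sail_im i (r y2 : R) :=
  planept (- (b i.-1 + r * b i) * y2 * (mu i.-1 + r)^-1) y2.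
Definition sail_map i u : cplane R :=
  (sail_re i (u 0 0) (u 0 1), sail_im i (u 0 0) (u 0 2)).
Definition triple (r s t : R) : 'rV[R]_3 :=
  \row_j (if j == 0 then r else if j == 1 then s else t).
(** On the sail this is r = - alpha_(i-1) / alpha_i. Written as a projection coefficient it makes
    sense wherever alpha_i <> 0, which gives the inverse chart on an open subset of the ambient
    space. *)
Definition sail_ratio i z :=
  - dot mu b c i z.1 z.2 * (P i z.1 * P i z.1 + Q i z.2 * Q i z.2)^-1.
Definition sail_chart i z : 'rV[R]_3 :=
  triple (sail_ratio i z) (z.1 0 1) (z.2 0 1).

Lemma triple0 r s t : triple r s t 0 0 = r. Proof. by rewrite mxE. Qed.
Lemma triple1 r s t : triple r s t 0 1 = s. Proof. by rewrite mxE. Qed.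
Lemma triple2 r s t : triple r s t 0 2 = t. Proof. by rewrite mxE. Qed.

Lemma triple_eta u : triple (u 0 0) (u 0 1) (u 0 2) = u.
Proof.
by apply/rowP => -[[|[|[|//]]] jlt]; rewrite mxE /=; congr (u _ _); apply/val_inj.
Qed.

(** * The coordinates (r, x_2, y_2) on one sail *)

Section Chart.
Variable i : nat.
Hypothesis i1n : (1 <= i <= n)%N.

Let i1 : (1 <= i)%N. Proof. by case/andP: i1n. Qed.
Let i_n : (i <= n)%N. Proof. by case/andP: i1n. Qed.

Lemma sail_reE r x : 0 < r ->
  P i.-1 x + r * P i x = 0 <-> x = sail_re i r (x 0 1).
Proof.
move=> r0; have D0 := ratio_den_gt0 conf i r0.
have E : P i.-1 x + r * P i x =
    (mu i.-1 + r) * (x 0 0 - sail_re i r (x 0 1) 0 0).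
  rewrite (re_partE conf _ i1) /re_part /im_part planept0; field.
  by rewrite gt_eqF.
rewrite E; split=> [/eqP|<-]; last by rewrite subrr mulr0.
rewrite mulf_eq0 gt_eqF //= subr_eq0 => /eqP x0.
by apply: plane_eqP; rewrite ?planept1.
Qed.

Lemma sail_imE r y : 0 < r ->
  Q i.-1 y + r * Q i y = 0 <-> y = sail_im i r (y 0 1).
Proof.
move=> r0; have D0 := ratio_den_gt0 conf i r0.
have E : Q i.-1 y + r * Q i y =
    (mu i.-1 + r) * (y 0 0 - sail_im i r (y 0 1) 0 0).
  rewrite (im_partE conf _ i1) /im_part planept0; field.
  by rewrite gt_eqF.
rewrite E; split=> [/eqP|<-]; last by rewrite subrr mulr0.
rewrite mulf_eq0 gt_eqF //= subr_eq0 => /eqP y0.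
by apply: plane_eqP; rewrite ?planept1.
Qed.

Lemma sail_re_on (r x2 : R) : 0 < r ->
  P i.-1 (sail_re i r x2) + r * P i (sail_re i r x2) = 0.
Proof. by move=> r0; apply/sail_reE; rewrite ?planept1. Qed.

Lemma sail_im_on (r y2 : R) : 0 < r ->
  Q i.-1 (sail_im i r y2) + r * Q i (sail_im i r y2) = 0.
Proof. by move=> r0; apply/sail_imE; rewrite ?planept1. Qed.

Lemma sail_ratioE r z : P i.-1 z.1 + r * P i z.1 = 0 ->
  Q i.-1 z.2 + r * Q i z.2 = 0 -> ~ (P i z.1 = 0 /\ Q i z.2 = 0) ->
  sail_ratio i z = r.
Proof.
move=> eP eQ nz.
have Pi : P i.-1 z.1 = - r * P i z.1 by move: eP; lra.
have Qi : Q i.-1 z.2 = - r * Q i z.2 by move: eQ; lra.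
rewrite /sail_ratio /dot Pi Qi; field.
rewrite -!expr2 paddr_eq0 ?sqr_ge0 // !sqrf_eq0.
by apply/negP => /andP[/eqP ? /eqP ?]; exact: nz.
Qed.

Lemma sail_mapK u : 0 < u 0 0 ->
  nonvanishing n mu b c (sail_map i u).1 (sail_map i u).2 ->
  sail_chart i (sail_map i u) = u.
Proof.
move=> u0 nz; rewrite /sail_chart (@sail_ratioE (u 0 0)) /= ?planept1.
- exact: triple_eta.
- exact: sail_re_on.
- exact: sail_im_on.
- exact: nz.
Qed.

Lemma sail_chartK z : in_S i z.1 z.2 ->
  0 < sail_ratio i z /\ sail_map i (sail_chart i z) = z.
Proof.
move=> zS; have [r r0 [eP eQ]] := in_S_ratio zS; have [nz _ _] := zS.
have rE : sail_ratio i z = r by apply: sail_ratioE => //; exact: nz.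
rewrite rE; split=> //.
rewrite /sail_map /sail_chart rE triple0 triple1 triple2.
by rewrite -(sail_reE _ r0).1 // -(sail_imE _ r0).1 // -surjective_pairing.
Qed.

Lemma sail_map_in_S u : 0 < u 0 0 ->
  nonvanishing n mu b c (sail_map i u).1 (sail_map i u).2 ->
  in_S i (sail_map i u).1 (sail_map i u).2.
Proof.
move=> u0 nz; apply: (ratio_in_S _ u0) => //.
  exact: sail_re_on.
exact: sail_im_on.
Qed.

Lemma open_coord_pos : open [set u : 'rV[R]_3 | 0 < u 0 0].
Proof. by apply: open_pos; exact: coord_continuous. Qed.

Lemma rational_sail_den (A : set 'rV[R]_3) : (forall u, A u -> 0 < u 0 0) ->
  rational_on A (fun u => (mu i.-1 + u 0 0)^-1).
Proof.
move=> A0; apply: rational_inv => [u /A0 u0|].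
  by rewrite gt_eqF // (ratio_den_gt0 conf).
by apply: rational_add; [exact: rational_cst | exact: rational_coord].
Qed.

Lemma smooth_sail_map (A : set 'rV[R]_3) : open A ->
  (forall u, A u -> 0 < u 0 0) -> smooth_on A (sail_map i).
Proof.
move=> Ao A0; have RD := rational_sail_den A0.
have Rb : rational_on A (fun u => b i.-1 + u 0 0 * b i).
  apply: rational_add; first exact: rational_cst.
  by apply: rational_mul; [exact: rational_coord | exact: rational_cst].
have Rc : rational_on A (fun u => c i.-1 + u 0 0 * c i).
  apply: rational_add; first exact: rational_cst.
  by apply: rational_mul; [exact: rational_coord | exact: rational_cst].
pose F (j : 'I_2) (u : 'rV[R]_3) := if j == 0 then
  (c i.-1 + u 0 0 * c i - (b i.-1 + u 0 0 * b i) * u 0 1) * (mu i.-1 + u 0 0)^-1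
  else u 0 1.
pose G (j : 'I_2) (u : 'rV[R]_3) := if j == 0 then
  - (b i.-1 + u 0 0 * b i) * u 0 2 * (mu i.-1 + u 0 0)^-1 else u 0 2.
have RF (j : 'I_2) : rational_on A (F j).
  rewrite /F; case: (j == 0); last exact: rational_coord.
  apply: rational_mul => //; apply: rational_add => //; apply: rational_opp.
  by apply: rational_mul => //; exact: rational_coord.
have RG (j : 'I_2) : rational_on A (G j).
  rewrite /G; case: (j == 0); last exact: rational_coord.
  apply: rational_mul => //; apply: rational_mul; last exact: rational_coord.
  exact: rational_opp.
exact: (smooth_cplane Ao RF RG).
Qed.

Lemma smooth_sail_chart (A : set (cplane R)) : open A ->
  (forall z, A z -> ~ (P i z.1 = 0 /\ Q i z.2 = 0)) ->
  smooth_on A (sail_chart i).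
Proof.
move=> Ao nz.
pose F (j : 'I_3) (z : cplane R) := if j == 0 then sail_ratio i z
  else if j == 1 then z.1 0 1 else z.2 0 1.
suff RF (j : 'I_3) : rational_on A (F j) by exact: (smooth_row Ao RF).
rewrite /F; case: (j == 0); last first.
  by case: (j == 1); [exact: rational_fst | exact: rational_snd].
apply: rational_mul; first by apply: rational_opp; exact: rational_dot.
apply: rational_inv => [z Az|].
  rewrite -!expr2 paddr_eq0 ?sqr_ge0 // !sqrf_eq0.
  by apply/negP => /andP[/eqP ? /eqP ?]; exact: (nz z).
by apply: rational_add; apply: rational_mul;
  do ?[exact: rational_re_part | exact: rational_im_part].
Qed.

(** A single global chart serves every point: the part of r > 0 that [sail_map] sends into the
    complement. *)
Lemma submanifold_in_S : submanifold 3 [set z | in_S i z.1 z.2].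
Proof.
move=> p pS.
pose M := [set z : cplane R | nonvanishing n mu b c z.1 z.2].
have Mo : open M by exact: open_nonvanishing.
have gsm := smooth_sail_map open_coord_pos (fun _ => id).
have Oo : open ([set u : 'rV[R]_3 | 0 < u 0 0] `&` sail_map i @^-1` M).
  rewrite openE => u [u0 Mu]; apply: filterI.
    by apply: open_nbhs_nbhs; split => //; exact: open_coord_pos.
  have [gc _] := gsm [::] u u0.
  by apply: gc; apply: open_nbhs_nbhs.
exists M, ([set u : 'rV[R]_3 | 0 < u 0 0] `&` sail_map i @^-1` M),
  (sail_map i), (sail_chart i).
split; split=> //.
- by case: pS.
- by apply: smooth_sail_map => // u [].
- by apply: smooth_sail_chart => // z; exact.
- apply/seteqP; split=> [_ [u [u0 Mu] <-]|z [zS Mz]].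
    by split=> //; exact: sail_map_in_S.
  have [r0 zE] := sail_chartK zS; exists (sail_chart i z) => //.
  by split; rewrite /= ?zE // triple0.
- by move=> u [u0 Mu]; exact: sail_mapK.
Qed.

(** At fixed r, each P_k is up to a positive factor B x_2 - A for k < i and A - B x_2 for k >= i,
    with B >= 0; lowering x_2 favours the required sign. *)
Lemma in_C_down (r x2 x2' : R) : 0 < r -> x2' <= x2 ->
  in_C i (sail_re i r x2) -> in_C i (sail_re i r x2').
Proof.
move=> r0 x22 [Cn Cp]; have D0 := ratio_den_gt0 conf i r0.
split=> k kin.
  have [k1 ki] := andP kin.
  have [A [B [A0 B0 PA _]]] := ratio_below conf i1 i_n r0 k1 ki.
  have := Cn k kin; rewrite -(pmulr_rlt0 (P k (sail_re i r x2)) D0)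
    -(pmulr_rlt0 (P k (sail_re i r x2')) D0) !PA ?planept1; do ?exact: sail_re_on.
  by apply: le_lt_trans; rewrite lerD2r ler_wpM2l.
have [ik kn] := andP kin.
have [A [B [A0 B0 PA _]]] := ratio_above conf i1 i_n r0 ik kn.
have := Cp k kin; rewrite -(pmulr_rgt0 (P k (sail_re i r x2)) D0)
    -(pmulr_rgt0 (P k (sail_re i r x2')) D0) !PA ?planept1; do ?exact: sail_re_on.
by move/lt_le_trans; apply; rewrite lerD2l lerN2 ler_wpM2l.
Qed.

Lemma in_C_low (r x2 : R) : 0 < r -> x2 <= 0 -> in_C i (sail_re i r x2).
Proof.
move=> r0 x20; apply: (in_C_down r0 x20).
have D0 := ratio_den_gt0 conf i r0; split=> k /andP[k1 k2].
  have [A [B [A0 B0 PA _]]] := ratio_below conf i1 i_n r0 k1 k2.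
  rewrite -(pmulr_rlt0 _ D0) PA ?planept1; last exact: sail_re_on.
  by rewrite mulr0 sub0r oppr_lt0.
have [A [B [A0 B0 PA _]]] := ratio_above conf i1 i_n r0 k1 k2.
rewrite -(pmulr_rgt0 _ D0) PA ?planept1; last exact: sail_re_on.
by rewrite mulr0 subr0.
Qed.

Lemma in_C_nonvanishing x y : in_C i x -> nonvanishing n mu b c x y.
Proof.
move=> [Cn Cp] k /andP[k1 kn] [Pk _].
have [ik|ki] := leqP i k.
  by have := Cp k; rewrite Pk ltxx ik kn => /(_ isT).
by have := Cn k; rewrite Pk ltxx k1 ki => /(_ isT).
Qed.

(** On the sail, y_2 = 0 means y = 0 by [ratio_real]. So the second clause removes exactly the real
    points outside C_i. *)
Definition in_S_circ x y := in_S i x y /\ (y 0 1 <> 0 \/ in_C i x).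

Lemma open_in_C : open [set z : cplane R | in_C i z.1].
Proof.
rewrite (_ : mkset _ = [set z | forall k, (1 <= k <= n)%N ->
    0 < (if (k < i)%N then - P k z.1 else P k z.1)]).
  apply: (@open_forall_le _ n (fun k =>
    [set z : cplane R | 0 < (if (k < i)%N then - P k z.1 else P k z.1)])) => k.
  apply: open_pos; apply: continuous_rational; case: (k < i)%N.
    by apply: rational_opp; exact: rational_re_part.
  exact: rational_re_part.
apply/seteqP; split=> z /=.
  move=> [Cn Cp] k /andP[k1 kn]; case: ltnP => ki.
    by rewrite oppr_gt0 Cn ?k1.
  by rewrite Cp ?ki.
move=> h; split=> k /andP[k1 k2].
  by have := h k; rewrite k2 oppr_gt0; apply; lia.
by have := h k; rewrite [(k < i)%N]ltnNge k1; apply; lia.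
Qed.

Lemma submanifold_in_S_circ : submanifold 3 [set z | in_S_circ z.1 z.2].
Proof.
rewrite (_ : mkset _ = [set z | in_S i z.1 z.2] `&`
    ([set z : cplane R | z.2 0 1 <> 0] `|` [set z : cplane R | in_C i z.1])) //.
apply: submanifold_open submanifold_in_S.
apply: openU; last exact: open_in_C.
by apply: open_neq0; apply: continuous_rational; exact: rational_snd.
Qed.

(** In the chart, lowering x_2 to min(0, x_2) stays inside, and the region r > 0, x_2 <= 0 is convex
    and entirely contained in [E]. The middle leg of the homotopy is constant, hence [f] occurs
    twice. *)
Lemma contractible_in_S_circ : contractible R [set z | in_S_circ z.1 z.2].
Proof.
pose E := [set u : 'rV[R]_3 | 0 < u 0 0 /\ (u 0 2 <> 0 \/ in_C i (sail_re i (u 0 0) (u 0 1)))].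
pose f (u : 'rV[R]_3) := triple (u 0 0) (Num.min 0 (u 0 1)) (u 0 2).
have E_low u : 0 < u 0 0 -> u 0 1 <= 0 -> E u.
  by move=> u0 u1; split=> //; right; exact: in_C_low.
have fc (u : 'rV[R]_3) : {for u, continuous f}.
  rewrite (_ : f = fun u => u 0 0 *: triple 1 0 0 +
      Num.min 0 (u 0 1) *: triple 0 1 0 + u 0 2 *: triple 0 0 1).
    apply: continuousD; first apply: continuousD.
    - by apply: continuousZr_tmp; exact: coord_continuous.
    - apply: continuousZr_tmp; apply: (@continuous_min R _ (fun=> 0)).
        exact: cst_continuous.
      exact: coord_continuous.
    - by apply: continuousZr_tmp; exact: coord_continuous.
  apply/funext => w; rewrite -[RHS]triple_eta /f !mxE /=.
  by congr triple; ring.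
have EE u : E u -> in_S_circ (sail_map i u).1 (sail_map i u).2.
  move=> [u0 uE]; split; last by rewrite planept1.
  apply: sail_map_in_S => //; case: uE => [u2|uC]; last exact: in_C_nonvanishing.
  move=> k k1n; apply: (ratio_nonvanishing conf i1n k1n u0).
  - exact: sail_re_on.
  - exact: sail_im_on.
  - by rewrite planept1; exact/eqP.
apply: (@contractible_3steps R _ _ _ E (sail_map i) (sail_chart i) f f (triple 1 0 0)).
- by apply: E_low; rewrite ?triple0 ?triple1.
- exact: EE.
- move=> z [zS zE]; have [r0 zK] := sail_chartK zS.
  split; rewrite triple0 ?triple1 ?triple2 //.
  case: zE => [z2|zC]; [by left|right].
  by move: zC; rewrite -{1}zK /= triple0 triple1.
- by move=> z [zS _]; have [] := sail_chartK zS.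
- move=> u [u0 _].
  by have [] := smooth_sail_map open_coord_pos (fun _ => id) [::] u0.
- move=> z [[nz _ _] _].
  pose M := [set z : cplane R | nonvanishing n mu b c z.1 z.2].
  have Mo : open M by exact: open_nonvanishing.
  have chsm : smooth_on M (sail_chart i).
    by apply: smooth_sail_chart => // w; exact.
  by have [] := chsm [::] z nz.
- by move=> u _; exact: fc.
- by move=> u _; exact: fc.
- move=> u t [u0 uE] /andP[t0 t1].
  have -> : u + t *: (f u - u) =
      triple (u 0 0) (u 0 1 + t * (Num.min 0 (u 0 1) - u 0 1)) (u 0 2).
    rewrite -[LHS]triple_eta /f !mxE /=; congr triple; ring.
  split; rewrite triple0 ?triple1 ?triple2 //.
  case: uE => [|uC]; [by left|right].
  apply: in_C_down uC => //; rewrite gerDl mulr_ge0_le0 //.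
  by rewrite subr_le0 ge_min lexx orbT.
- move=> u t [u0 uE] _; rewrite subrr scaler0 addr0.
  by apply: E_low; rewrite ?triple0 // triple1 ge_min lexx.
- move=> u t [u0 uE] /andP[t0 t1].
  have m0 : Num.min 0 (u 0 1) <= 0 by rewrite ge_min lexx.
  apply: E_low; rewrite !mxE /=.
    have -> : u 0 0 + t * (1 - u 0 0) = (1 - t) * u 0 0 + t by ring.
    have [->|t1'] := eqVneq t 1; first by rewrite subrr mul0r add0r.
    by rewrite ltr_pwDl // mulr_gt0 // subr_gt0 lt_neqAle t1'.
  have -> : Num.min 0 (u 0 1) + t * (0 - Num.min 0 (u 0 1)) =
    (1 - t) * Num.min 0 (u 0 1) by ring.
  by rewrite mulr_ge0_le0 // subr_ge0.
Qed.

End Chart.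

(* At a real point the tangent space of S_i is the sum of R^2 and of the
   imaginary line spanned by this vector. *)
Definition sail_dir i x := planept (P i.-1 x * b i - P i x * b i.-1)
  (P i x * mu i.-1 - P i.-1 x * mu i).

Lemma im_part_prev_dir i x :
  Q i.-1 (sail_dir i x) = P i.-1 x * (mu i.-1 * b i - b i.-1 * mu i).
Proof. by rewrite /im_part planept0 planept1; ring. Qed.

Lemma im_part_dir i x :
  Q i (sail_dir i x) = P i x * (mu i.-1 * b i - b i.-1 * mu i).
Proof. by rewrite /im_part planept0 planept1; ring. Qed.

Lemma in_S_realE i x : in_S i x 0 <->
  (forall k, (1 <= k <= n)%N -> P k x <> 0) /\ P i.-1 x * P i x < 0.
Proof.
rewrite /(in_S _ _ _) /cross /dot !im_part_at0 !mulr0 subrr addr0; split=> [[nz _ d]|[nz d]].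
  by split=> // k k1n Pk; apply: (nz k k1n); rewrite im_part_at0.
by split=> // k k1n [Pk _]; exact: (nz k).
Qed.

(** Along this direction Q_(i-1) and Q_i are the same multiple e of P_(i-1) and P_i. Both equations
    are thus multiplied by 1 + i t e (i here the imaginary unit), and their quotient does not
    change. *)
Lemma in_S_dir i x t : in_S i x 0 -> in_S i x (t *: sail_dir i x).
Proof.
move=> /in_S_realE[nz PP].
split; first by move=> k k1n [Pk _]; exact: (nz k).
  by rewrite /cross !im_part_scale im_part_dir im_part_prev_dir; ring.
rewrite /dot !im_part_scale im_part_dir im_part_prev_dir.
set e := mu i.-1 * b i - b i.-1 * mu i.
have -> : P i.-1 x * P i x + t * (P i.-1 x * e) * (t * (P i x * e)) =
  P i.-1 x * P i x * (1 + (t * e) ^+ 2) by ring.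
by rewrite pmulr_llt0 // ltr_pwDl // sqr_ge0.
Qed.

Lemma sail_dir_neq0 i x : (1 <= i)%N -> in_S i x 0 -> sail_dir i x 0 1 != 0.
Proof.
move=> i1 /in_S_realE[_ PP]; rewrite planept1 (conf_mu conf i1) mulr1 subr_eq0.
apply: contraTneq PP => <-; rewrite -leNgt mulrAC -expr2.
by rewrite mulr_ge0 ?sqr_ge0 // (mu_ge0 conf).
Qed.

(** Transversality follows from disjointness off the real points: were the two directions
    proportional, moving along them would give a nonreal common point of both sails. *)
Lemma sail_dir_det i j x : (1 <= i <= n)%N -> (1 <= j <= n)%N -> i <> j ->
  in_S i x 0 -> in_S j x 0 ->
  sail_dir i x 0 0 * sail_dir j x 0 1 - sail_dir i x 0 1 * sail_dir j x 0 0 != 0.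
Proof.
move=> i1n j1n ij Si Sj; apply/eqP => det0.
have i2 := sail_dir_neq0 (proj1 (andP i1n)) Si.
have j2 := sail_dir_neq0 (proj1 (andP j1n)) Sj.
have e : sail_dir i x = (sail_dir i x 0 1 / sail_dir j x 0 1) *: sail_dir j x.
  apply: plane_eqP; rewrite [RHS]mxE; last by rewrite divfK.
  apply: (mulIf j2); rewrite mulrAC divfK //; apply/eqP.
  by rewrite -subr_eq0 det0.
have Si' := in_S_dir 1 Si; rewrite scale1r in Si'.
have Sj' := in_S_dir (sail_dir i x 0 1 / sail_dir j x 0 1) Sj.
rewrite -e in Sj'.
have d0 := in_S_meet conf i1n j1n ij Si' Sj'.
by move: i2; rewrite d0 mxE eqxx.
Qed.

Lemma tangent_in_S i x v (s : R) : in_S i x 0 ->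
  tangent_space [set z | in_S i z.1 z.2] (x, 0) (v, s *: sail_dir i x).
Proof.
move=> Six.
pose J := [set t : R | in_S i (x + t *: v) 0].
(* A straight line need not stay in the sail because [sail_dir] varies with the real part; the curve
   recomputes it at x + t v. *)
pose gam (t : R) : cplane R := (x + t *: v, (t * s) *: sail_dir i (x + t *: v)).
have Jo : open J.
  have lc : continuous (fun t : R => (x + t *: v, 0) : cplane R).
    move=> t; apply: (@continuous_pairing R (plane R) (plane R)
      (fun t : R => x + t *: v) (fun=> 0) t).
      2: exact: cst_continuous.
    apply: (@continuousD _ _ _ (fun=> x)); first exact: cst_continuous.
    by apply: (@continuousZr_tmp _ _ _ id); exact: id.
  rewrite (_ : J = (fun t : R => (x + t *: v, 0) : cplane R) @^-1`
      ([set z | nonvanishing n mu b c z.1 z.2] `&`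
       [set z | 0 < - dot mu b c i z.1 z.2])).
    apply: open_comp => [t _|]; first exact: lc.
    apply: openI; first exact: open_nonvanishing.
    apply: open_pos; apply: continuous_rational; apply: rational_opp.
    exact: rational_dot.
  apply/seteqP; split=> t /=; rewrite oppr_gt0; first by case.
  by case=> nz d; split=> //; rewrite /cross !im_part_at0 !mulr0 subrr.
have RP k : rational_on J (fun t => P k x + t * Q k v).
  apply: rational_add; first exact: rational_cst.
  by apply: rational_mul; [exact: rational_id | exact: rational_cst].
have sm : smooth_on J gam.
  pose F (j : 'I_2) (t : R) := x 0 j + t * v 0 j.
  pose G (j : 'I_2) (t : R) := (t * s) * (if j == 0 then
    (P i.-1 x + t * Q i.-1 v) * b i - (P i x + t * Q i v) * b i.-1
    else (P i x + t * Q i v) * mu i.-1 - (P i.-1 x + t * Q i.-1 v) * mu i).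
  rewrite (_ : gam = (fun t => (\row_j F j t, \row_j G j t))); last first.
    apply/funext => t; rewrite /gam; congr pair; apply/rowP => j; rewrite !mxE //.
    by rewrite /G !re_part_shift.
  apply: smooth_cplane => // j.
    apply: rational_add; first exact: rational_cst.
    by apply: rational_mul; [exact: rational_id | exact: rational_cst].
  apply: rational_mul.
    by apply: rational_mul; [exact: rational_id | exact: rational_cst].
  case: (j == 0); (apply: rational_add; last apply: rational_opp);
    by apply: rational_mul => //; exact: rational_cst.
have J0 : J 0 by rewrite /J /= scale0r addr0.
exists J, gam; split; split=> //.
- by rewrite /gam scale0r addr0 mul0r scale0r.
- by move=> t Jt; exact: in_S_dir.
apply: cvg_lim => //.
(* For h <> 0 the difference quotient of [gam] at 0 equals [lim_dir h] exactly, so the derivative is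
   a matter of continuity. *)
pose lim_dir (h : R) : cplane R := (v, s *: sail_dir i (x + h *: v)).
have -> : (v, s *: sail_dir i x) = lim_dir 0 by rewrite /lim_dir scale0r addr0.
have dirc : {for 0, continuous lim_dir}.
  apply: continuous_pairing; first exact: cst_continuous.
  apply: (@continuousZ _ _ _ (fun=> s)); first exact: cst_continuous.
  have Pc k : {for 0, continuous (fun h : R => P k (x + h *: v))}.
    rewrite (_ : (fun h => _) = (fun t => P k x + t * Q k v)).
      exact: (rational_continuous (RP k)).
    by apply/funext => h; rewrite re_part_shift.
  by apply: continuous_planept; apply: continuousB;
    (apply: continuousM; [exact: Pc | exact: cst_continuous]).
have dirc' : lim_dir h @[h --> 0^'] --> lim_dir 0.
  by apply: cvg_trans dirc; apply: cvg_app; exact: nbhs_dnbhs.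
apply: cvg_trans dirc'; apply: near_eq_cvg; near=> h.
have h0 : h != 0 by near: h; exact: nbhs_dnbhs_neq.
rewrite /gam /lim_dir addr0 scale0r addr0 mul0r scale0r.
apply: injective_projections => /=.
  by rewrite addrAC subrr add0r scalerA mulVf // scale1r.
by rewrite subr0 scalerA mulrA mulVf // mul1r.
Unshelve. all: by end_near. Qed.

Lemma transverse_in_S i j : (1 <= i <= n)%N -> (1 <= j <= n)%N -> i <> j ->
  transverse [set z | in_S i z.1 z.2] [set z | in_S j z.1 z.2].
Proof.
move=> i1n j1n ij [x y] /= Si Sj [v1 v2].
have y0 := in_S_meet conf i1n j1n ij Si Sj.
rewrite y0 in Si Sj *.
have det := sail_dir_det i1n j1n ij Si Sj.
set d := _ - _ in det.
(* Cramer's rule for v2 = s d_i + t d_j, where d_i and d_j are the two sail directions. The real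
   part v1 is left entirely to the first tangent space, which contains all of R^2. *)
pose s := (v2 0 0 * sail_dir j x 0 1 - v2 0 1 * sail_dir j x 0 0) / d.
pose t := (sail_dir i x 0 0 * v2 0 1 - sail_dir i x 0 1 * v2 0 0) / d.
exists (v1, s *: sail_dir i x), (0, t *: sail_dir j x).
split; [exact: tangent_in_S | exact: tangent_in_S |].
apply: injective_projections => /=; first by rewrite addr0.
by apply: plane_eqP; rewrite [RHS]mxE [X in X + _]mxE [X in _ + X]mxE /s /t /d; field.
Qed.

End Sails.

(** * Chambers *)

Section Components.
Variables (R : realType) (n : nat) (mu b c : nat -> R).
Hypothesis conf : configuration n mu b c.
Implicit Types (x y w : plane R) (z : cplane R) (i j k : nat).
Local Notation P := (re_part mu b c).
Local Notation Q := (im_part mu b).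
Local Notation in_S := (in_S n mu b c).
Local Notation in_C := (in_C n mu b c).

(** Lagrange's identity: the product of the squared norms is cross^2 + dot^2. It bridges the weak
    inequality of [in_U] and the strict one of [in_S]. *)
Lemma nonvanishing_dot_neq0 x y k : nonvanishing n mu b c x y ->
  (1 <= k <= n)%N -> cross mu b c k x y = 0 -> dot mu b c k x y <> 0.
Proof.
move=> nz k1n cr dt.
have nk i : (i <= n)%N -> P i x ^+ 2 + Q i y ^+ 2 <> 0.
  move=> i_n /eqP; rewrite paddr_eq0 ?sqr_ge0 // !sqrf_eq0 => /andP[/eqP Pi /eqP Qi].
  case: i i_n Pi Qi => [|i] i_n Pi Qi; last exact: (nz i.+1).
  by move/eqP: Pi; rewrite (re_part0 conf) oppr_eq0 oner_eq0.
have : (P k.-1 x ^+ 2 + Q k.-1 y ^+ 2) * (P k x ^+ 2 + Q k y ^+ 2) =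
    cross mu b c k x y ^+ 2 + dot mu b c k x y ^+ 2.
  by rewrite /cross /dot; ring.
rewrite cr dt expr0n addr0 => /eqP; rewrite mulf_eq0 => /orP[] /eqP; apply: nk; lia.
Qed.

Lemma in_UE x y : in_U n mu b c x y <->
  nonvanishing n mu b c x y /\ forall i, (1 <= i <= n)%N -> ~ in_S i x y.
Proof.
split=> [xyU|[nz nS] k k1n [cr dt]].
  split=> [k k1n [Pk Qk]|i i1n [_ cr dt]]; last first.
    by apply: (xyU i) => //; split=> //; exact: ltW.
  by apply: (xyU k) => //; rewrite /cross /dot Pk Qk !mulr0 !mul0r subrr addr0.
apply: (nS k k1n); split=> //; rewrite lt_neqAle dt andbT; apply/eqP.
exact: nonvanishing_dot_neq0.
Qed.

Definition real_nonvanishing : set (plane R) :=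
  [set x | forall k, (1 <= k <= n)%N -> P k x <> 0].

Lemma real_nonvanishing0 x k : real_nonvanishing x -> (k <= n)%N -> P k x != 0.
Proof.
case: k => [|k] nz kn; first by rewrite (re_part0 conf) oppr_eq0 oner_eq0.
exact/eqP/nz.
Qed.

Lemma component_sign x w k : connected_component real_nonvanishing x w ->
  (k <= n)%N -> 0 < P k x * P k w.
Proof.
move=> xw kn.
have /connected_component_sub nw := xw.
have nx : real_nonvanishing x.
  by apply/(connected_component_sub (connected_component_sym xw)).
have Cc := @component_connected _ real_nonvanishing x.
have Pc : continuous (P k).
  move=> u; apply: (@continuousB _ _ _ (im_part mu b k) (fun=> c k) u).
    2: exact: cst_continuous.
  apply: (@continuousD _ _ _ (fun u : plane R => mu k * u 0 0) (fun u => b k * u 0 1) u);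
    (apply: continuousM; [exact: cst_continuous | exact: coord_continuous]).
have /connected_intervalP itv : connected (P k @` connected_component real_nonvanishing x).
  by apply: connected_continuous_connected => //; exact: continuous_subspaceT.
have no0 : ~ (P k @` connected_component real_nonvanishing x) 0.
  move=> [u /connected_component_sub nu /eqP].
  by apply/negP; exact: real_nonvanishing0.
have xC : (P k @` connected_component real_nonvanishing x) (P k x).
  by exists x => //; exact: connected_component_refl.
have wC : (P k @` connected_component real_nonvanishing x) (P k w) by exists w.
have [x0|x0] := ltP 0 (P k x); have [w0|w0] := ltP 0 (P k w).
- exact: mulr_gt0.
- by case: no0; apply: (itv _ _ wC xC); rewrite w0 ltW.
- by case: no0; apply: (itv _ _ xC wC); rewrite x0 ltW.
- by rewrite nmulr_rgt0 lt_neqAle ?w0 ?x0 real_nonvanishing0.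
Qed.

(** The segment from x to w crosses no line. With [component_sign], this identifies chambers with
    sign classes. *)
Lemma sign_component x w :
  (forall k, (1 <= k <= n)%N -> 0 < P k x * P k w) ->
  connected_component real_nonvanishing x w.
Proof.
move=> xw.
apply: (@connected_component_max _ _ [set x + t *: (w - x) | t in `[0, 1]%classic]).
- by exists 0; rewrite ?scale0r ?addr0 //= in_itv /= lexx ler01.
- move=> _ [t /= + <-] k k1n; rewrite in_itv /= => /andP[t0 t1].
  rewrite re_part_convex => e.
  have PP := xw k k1n.
  have /eqP : (1 - t) * P k x ^+ 2 + t * (P k x * P k w) = 0.
    by rewrite -[RHS](mulr0 (P k x)) -e; ring.
  rewrite paddr_eq0; last 2 first.
  - by rewrite mulr_ge0 ?sqr_ge0 // subr_ge0.
  - by rewrite mulr_ge0 // ltW.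
  rewrite [t * _ == 0]mulf_eq0 (gt_eqF PP) orbF => /andP[+ /eqP t00].
  rewrite t00 subr0 mul1r sqrf_eq0 => /eqP Px.
  by move: PP; rewrite Px mul0r ltxx.
- exact: line_segment_connected.
- by exists 1; rewrite ?scale1r ?subrKC //= in_itv /= lexx ler01.
Qed.

Lemma in_C_sign i x w : in_C i x -> in_C i w ->
  forall k, (1 <= k <= n)%N -> 0 < P k x * P k w.
Proof.
move=> [xn xp] [wn wp] k /andP[k1 kn]; have [ik|ki] := leqP i k.
  by rewrite mulr_gt0 ?xp ?wp ?ik.
by rewrite nmulr_rgt0 ?xn ?wn ?k1.
Qed.

(** On F^1 the P_k increase with k, so a chamber meeting F^1 has negative signs followed by positive
    ones. Membership in S_i places the change between [i.-1] and [i]. *)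
Lemma in_C_of_trace i x w : (1 <= i <= n)%N -> in_S i x 0 -> w 0 1 = 0 ->
  connected_component real_nonvanishing x w -> in_C i x.
Proof.
move=> /andP[i1 i_n] /in_S_realE[nz PP] w1 xw.
have sg k : (k <= n)%N -> 0 < P k x * P k w by exact: component_sign.
have mono j k : (1 <= j)%N -> (j <= k)%N -> (k <= n)%N -> P j w <= P k w.
  by move=> j1 jk kn; apply: (re_part_le conf) => //; rewrite w1.
have Pi : 0 < P i w.
  rewrite ltNge; apply/negP => Piw.
  have Pix : P i x < 0.
    have := sg i i_n; case: (ltgtP (P i x) 0) => // Pix.
      by rewrite pmulr_rgt0 // ltNge Piw.
    by rewrite Pix mul0r ltxx.
  have Pjx : 0 < P i.-1 x by move: PP; rewrite nmulr_llt0.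
  (* For i = 1 the contradiction is P_0 = -1, since index 0 is not part of the increasing
     sequence. *)
  case: i i1 i_n Piw Pjx {PP Pix} => [|[|i]] // _ i_n Piw /= Pjx.
    by move: Pjx; rewrite (re_part0 conf); lra.
  have : 0 < P i.+1 w by move: (sg i.+1 (ltnW i_n)); rewrite pmulr_rgt0.
  by rewrite ltNge (le_trans _ Piw) // mono.
have Pix : 0 < P i x by move: (sg i i_n); rewrite pmulr_lgt0.
have Pjx : P i.-1 x < 0 by move: PP; rewrite pmulr_llt0.
split=> k /andP[k1 k2]; last first.
  have : 0 < P k w by apply: lt_le_trans Pi _; exact: mono.
  by move=> Pk; move: (sg k k2); rewrite pmulr_lgt0.
have Pjw : P i.-1 w < 0.
  by have := sg i.-1 (leq_trans (leq_pred i) i_n); rewrite nmulr_rgt0.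
have Pk : P k w < 0 by apply: le_lt_trans Pjw; apply: mono; lia.
by have := sg k; rewrite nmulr_lgt0 //; apply; lia.
Qed.

End Components.



(** * From the given arrangement to its normal form *)

Section Transfer.
Variables (R : realType) (n : nat) (alpha : nat -> affpoly R) (a : nat -> R).
Hypothesis Hnorm : normalized n alpha a.
Implicit Types (x y w : plane R) (z : cplane R) (i j k : nat).

(* alpha_k = scale_k (mu_k x_1 + b_k x_2 - c_k) with scale_k > 0; the index 0
   stands for alpha_0 = -1. *)
Definition normal_scale k := if k is 0 then 1 else aff_lin (alpha k) 0 0.
Definition normal_mu k : R := if k is 0 then 0 else 1.
Definition normal_b k :=
  if k is 0 then 0 else aff_lin (alpha k) 0 1 / aff_lin (alpha k) 0 0.
Definition normal_c k := if k is 0 then 1 else a k.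
Local Notation m k := (aff_lin (alpha k) 0 0).
Local Notation l k := (aff_lin (alpha k) 0 1).
Local Notation scale := normal_scale.
Local Notation mu := normal_mu.
Local Notation b := normal_b.
Local Notation c := normal_c.
Local Notation P := (re_part mu b c).
Local Notation Q := (im_part mu b).

Lemma aevalE k x :
  aeval (alpha k) x = aff_const (alpha k) + (m k * x 0 0 + l k * x 0 1).
Proof.
rewrite /aeval !big_ord_recl big_ord0 addr0; congr (_ + (_ + _)).
by congr (aff_lin _ _ _ * x _ _); apply/val_inj.
Qed.

Lemma aff_constE k : (1 <= k <= n)%N -> aff_const (alpha k) = - (m k * a k).
Proof.
move=> k1n; have : (zero_line (alpha k) `&` @F1 R) (planept (a k) 0).
  by rewrite (normalized_trace Hnorm).
case=> + _; rewrite /zero_line /= aevalE planept0 planept1 mulr0 addr0.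
by move/eqP; rewrite addr_eq0 => /eqP.
Qed.

(** The value of alpha_k at the origin is -m_k a_k, and a_k > 0. Positive scaling factors are what
    lets sails and chamber signs survive normalization. *)
Lemma slope_gt0 k : (1 <= k <= n)%N -> 0 < m k.
Proof.
move=> k1n; have := normalized_sign Hnorm k1n.
rewrite aevalE !mxE !mulr0 !addr0 aff_constE // oppr_lt0.
by rewrite pmulr_lgt0 // (normalized_pos Hnorm).
Qed.

Lemma scale_gt0 k : (k <= n)%N -> 0 < scale k.
Proof. by case: k => [|k] kn //; exact: slope_gt0. Qed.

Lemma aeval_scale k x : (k <= n)%N -> aeval (alpha k) x = scale k * P k x.
Proof.
case: k => [|k] kn.
  rewrite aevalE (normalized_alpha0 Hnorm) /= !mxE /re_part /im_part /=.
  ring.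
have mk : 0 < m k.+1 by exact: slope_gt0.
rewrite aevalE aff_constE // /re_part /im_part /= /normal_b /normal_c.
by field; rewrite gt_eqF.
Qed.

Lemma aevalC_scale k z : (k <= n)%N ->
  aevalC (alpha k) z = ((scale k * P k z.1) +i* (scale k * Q k z.2))%C.
Proof.
move=> kn; rewrite -aeval_scale // aevalE.
have -> : scale k * Q k z.2 = m k * z.2 0 0 + l k * z.2 0 1.
  case: k kn => [|k] kn.
    by rewrite (normalized_alpha0 Hnorm) /= !mxE /im_part /=; ring.
  by rewrite /im_part /= /normal_b; field; rewrite gt_eqF // slope_gt0.
rewrite /aevalC !big_ord_recl big_ord0 addr0 /ccoord.
have -> : lift ord0 ord0 = 1 :> 'I_2 by apply/val_inj.
by apply/eqP; rewrite eq_complex /= !mul0r !subr0 !addr0 !add0r !eqxx.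
Qed.

Lemma normalized_configuration : configuration n mu b c.
Proof.
split=> // [[]//|[|k] // k1n|[|j] [|k] // _ jk kn|[|j] [|k] // _ jk kn].
- exact: normalized_pos Hnorm _ _.
- exact: normalized_decr Hnorm _ _ _ _ _.
(* Were b to increase from j to k, the two lines would meet at height (a_k - a_j) / (b_k - b_j) < 0,
   against [normalized_upper]. *)
rewrite leNgt; apply/negP => bjk.
have jn : (1 <= j.+1 <= n)%N by lia.
have k1n : (1 <= k.+1 <= n)%N by lia.
have ajk := normalized_decr Hnorm (ltn0Sn j) jk kn.
have bb : b k.+1 - b j.+1 != 0 by rewrite subr_eq0 gt_eqF.
pose x2 := (a k.+1 - a j.+1) / (b k.+1 - b j.+1).
pose x := planept (a j.+1 - b j.+1 * x2) x2.
have Pj : aeval (alpha j.+1) x = 0.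
  rewrite aeval_scale; last lia.
  by rewrite /re_part /im_part /x planept0 planept1 /normal_mu /normal_c mul1r subrK subrr mulr0.
have Pk : aeval (alpha k.+1) x = 0.
  rewrite aeval_scale //.
  suff -> : P k.+1 x = 0 by rewrite mulr0.
  rewrite /re_part /im_part /x planept0 planept1 /normal_mu /normal_c /x2.
  move: (b k.+1) (b j.+1) bb => bk bj bb.
  by field.
have jk' : j.+1 <> k.+1 by lia.
have := normalized_upper Hnorm jn k1n jk' Pj Pk.
rewrite /x planept1 pmulr_lgt0 ?invr_gt0 ?subr_gt0 //.
by rewrite ltNge ltW.
Qed.
Local Notation conf := normalized_configuration.

Lemma complementE : complement n alpha =
  [set z | nonvanishing n mu b c z.1 z.2].
Proof.
have aE k z : (1 <= k <= n)%N ->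
    (aevalC (alpha k) z = 0) <-> (P k z.1 = 0 /\ Q k z.2 = 0).
  move=> /andP[k1 kn]; rewrite aevalC_scale //; have s0 := scale_gt0 kn.
  split=> [[/eqP + /eqP]|[-> ->]]; last by rewrite !mulr0.
  by rewrite !mulf_eq0 (gt_eqF s0) => /eqP ? /eqP.
by apply/seteqP; split=> z /= nz k k1n /(aE k z k1n); exact: nz.
Qed.

Lemma S_E i : (1 <= i <= n)%N ->
  S_ n alpha i = [set z | in_S n mu b c i z.1 z.2].
Proof.
move=> i1n; have i_n : (i <= n)%N by lia.
have i'n : (i.-1 <= n)%N by lia.
have s0 := scale_gt0 i_n; have s0' := scale_gt0 i'n.
rewrite /S_ complementE; apply/seteqP; split=> z /=.
  move=> [[/eqP + [r r0 e]] nz]; rewrite mulf_eq0 negb_or => /andP[p0 q0].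
  have /eqP : aevalC (alpha i.-1) z = (r%:C)%C * aevalC (alpha i) z.
    by rewrite -e divfK.
  rewrite !aevalC_scale // eq_complex /= !mul0r subr0 addr0 => /andP[/eqP eP /eqP eQ].
  (* The sail has alpha_(i-1) = r alpha_i with r < 0. The positive ratio for the normalized
     equations is -r, corrected by the two scaling factors. *)
  apply: (@ratio_in_S _ _ _ _ _ i _ _ (- r * scale i / scale i.-1)) => //.
  - by rewrite divr_gt0 // mulr_gt0 // oppr_gt0.
  - apply: (mulfI (lt0r_neq0 s0')); rewrite mulrDr mulr0 eP.
    by field; rewrite gt_eqF.
  - apply: (mulfI (lt0r_neq0 s0')); rewrite mulrDr mulr0 eQ.
    by field; rewrite gt_eqF.
move=> zS; have [nz _ _] := zS; have [r r0 [eP eQ]] := in_S_ratio zS.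
have q0 : aevalC (alpha i) z != 0.
  have /(_ i i1n)/eqP : complement n alpha z by rewrite complementE; exact: nz.
  exact.
have r'0 : - r * scale i.-1 / scale i < 0.
  by rewrite !mulNr oppr_lt0 divr_gt0 // mulr_gt0.
have e : aevalC (alpha i.-1) z =
    ((- r * scale i.-1 / scale i)%:C)%C * aevalC (alpha i) z.
  rewrite !aevalC_scale //; apply/eqP; rewrite eq_complex /= !mul0r subr0 addr0.
  have -> : P i.-1 z.1 = - r * P i z.1 by move: eP; lra.
  have -> : Q i.-1 z.2 = - r * Q i z.2 by move: eQ; lra.
  by apply/andP; split; apply/eqP; field; rewrite gt_eqF.
split=> //; split; last by exists (- r * scale i.-1 / scale i) => //; rewrite e mulfK.
apply/eqP; rewrite e !mulf_neq0 //.
by rewrite eq_complex /= eqxx andbT lt_eqF.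
Qed.

Lemma U_E : U_ n alpha = [set z | in_U n mu b c z.1 z.2].
Proof.
rewrite /U_ complementE; apply/seteqP; split=> z /=.
  move=> [nz nS]; apply/(in_UE conf); split=> // i i1n zS.
  by apply: nS; exists i; rewrite ?S_E.
move=> /(in_UE conf)[nz nS]; split=> // -[i /= i1n].
by rewrite S_E //; exact: nS.
Qed.

Lemma real_complementE : real_complement n alpha = real_nonvanishing n mu b c.
Proof.
have aE k x : (1 <= k <= n)%N -> aeval (alpha k) x = 0 <-> P k x = 0.
  move=> /andP[k1 kn]; rewrite aeval_scale //; have s0 := scale_gt0 kn.
  split=> [/eqP|->]; last by rewrite mulr0.
  by rewrite mulf_eq0 (gt_eqF s0) => /eqP.
by apply/seteqP; split=> x nz k k1n /(aE k x k1n); exact: nz.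
Qed.

Lemma chamber_component C x : chamber n alpha C -> C x ->
  C = connected_component (real_nonvanishing n mu b c) x /\
  real_nonvanishing n mu b c x.
Proof.
rewrite /chamber real_complementE => -[w nw ->] wx; split.
  exact: same_connected_component.
exact: connected_component_sub wx.
Qed.

Lemma component_chamber x : real_nonvanishing n mu b c x ->
  chamber n alpha (connected_component (real_nonvanishing n mu b c) x).
Proof. by move=> nx; exists x; rewrite real_complementE. Qed.

Lemma S_circE i : (1 <= i <= n)%N ->
  S_circ n alpha i = [set z | in_S_circ n mu b c i z.1 z.2].
Proof.
move=> i1n; rewrite /S_circ S_E //; apply/seteqP; split=> -[x y] /=.
  move=> [xyS nC]; split=> //; have [y1|/eqP y1] := eqVneq (y 0 1) 0; last by left.
  right; have [r r0 [_ eQ]] := in_S_ratio xyS.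
  have i1 : (1 <= i)%N by lia.
  have y0 := ratio_real conf i1 r0 eQ y1.
  rewrite {}y0 {eQ y1} in xyS nC.
  have nx : real_nonvanishing n mu b c x by have [] := (in_S_realE _ _ _ _ _ _).1 xyS.
  have xx := connected_component_refl nx.
  apply: contrapT => xC; apply: nC.
  exists (connected_component (real_nonvanishing n mu b c) x); last by exists x.
  split; first exact: component_chamber.
  rewrite -subset0 => w [xw w1]; apply: xC.
  exact: (in_C_of_trace conf i1n xyS w1 xw).
move=> [xyS xyE]; split=> // -[C [Cch CF] [x' Cx' [ex ey]]].
subst x' y; case: xyE => [|xC]; first by rewrite mxE.
have [Ce _] := chamber_component Cch Cx'.
(* A witness that C_i meets F^1: the point with x_2 = 0 and ratio 1, an arbitrary positive value. *)
have wC : in_C n mu b c i (sail_re mu b c i 1 0) by exact: (in_C_low conf).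
suff : (C `&` @F1 R) (sail_re mu b c i 1 0) by rewrite CF.
split; last by rewrite /F1 /= planept1.
by rewrite Ce; apply: sign_component; exact: (in_C_sign xC wC).
Qed.

Lemma S_meetE i j : (1 <= i <= n)%N -> (1 <= j <= n)%N -> i <> j ->
  S_ n alpha i `&` S_ n alpha j =
    \bigcup_(C in chambers_ij n alpha i j) real_points C.
Proof.
move=> i1n j1n ij; rewrite !S_E //; apply/seteqP; split=> [[x y] /= [Si Sj]|].
  have y0 := in_S_meet conf i1n j1n ij Si Sj; rewrite {}y0 in Si Sj *.
  have [nx _] := (in_S_realE _ _ _ _ _ _).1 Si.
  have opp k : (1 <= k <= n)%N -> in_S n mu b c k x 0 ->
      opposite_on (alpha k) (alpha k.-1)
        (connected_component (real_nonvanishing n mu b c) x).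
    move=> k1n /in_S_realE[_ PP].
    have kn : (k <= n)%N by lia.
    have k'n : (k.-1 <= n)%N by lia.
    have [Pk|Pk] := ltP (P k x) 0; [left|right]; split=> w xw.
    - rewrite aeval_scale // pmulr_rlt0 ?scale_gt0 //.
      by have := component_sign conf xw kn; rewrite nmulr_rgt0.
    - rewrite aeval_scale // pmulr_rgt0 ?scale_gt0 //.
      have := component_sign conf xw k'n; rewrite pmulr_rgt0 //.
      by move: PP; rewrite nmulr_llt0.
    - have Pk' : 0 < P k x.
        by rewrite lt_neqAle Pk eq_sym (real_nonvanishing0 conf nx).
      rewrite aeval_scale // pmulr_rgt0 ?scale_gt0 //.
      by have := component_sign conf xw kn; rewrite pmulr_rgt0.
    have Pk' : 0 < P k x.
      by rewrite lt_neqAle Pk eq_sym (real_nonvanishing0 conf nx).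
    rewrite aeval_scale // pmulr_rlt0 ?scale_gt0 //.
    have := component_sign conf xw k'n; rewrite nmulr_rgt0 //.
    by move: PP; rewrite pmulr_llt0.
  exists (connected_component (real_nonvanishing n mu b c) x).
    by split; [exact: component_chamber | exact: opp | exact: opp].
  by exists x => //; exact: connected_component_refl.
move=> _ [C [Cch Ci Cj] [x Cx <-]] /=.
have [_ nx] := chamber_component Cch Cx.
have opp k : (1 <= k <= n)%N -> opposite_on (alpha k) (alpha k.-1) C ->
    in_S n mu b c k x 0.
  move=> k1n kC; have kn : (k <= n)%N by lia.
  have k'n : (k.-1 <= n)%N by lia.
  apply/in_S_realE; split=> //; case: kC => -[/(_ x Cx) + /(_ x Cx)].
    rewrite !aeval_scale // pmulr_rlt0 ?scale_gt0 // pmulr_rgt0 ?scale_gt0 //.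
    by move=> Pk Pk'; rewrite pmulr_rlt0.
  rewrite !aeval_scale // pmulr_rgt0 ?scale_gt0 // pmulr_rlt0 ?scale_gt0 //.
  by move=> Pk Pk'; rewrite nmulr_rlt0.
by split; exact: opp.
Qed.

Lemma trivIset_chambers (D : set (set (plane R))) : D `<=` chamber n alpha ->
  trivIset D (@real_points R).
Proof.
move=> Dch A B DA DB [_ [[x Ax <-] [w Bw [e]]]]; subst w.
have [-> _] := chamber_component (Dch _ DA) Ax.
by have [-> _] := chamber_component (Dch _ DB) Bw.
Qed.

(** Inside the complement, [cross] and [dot] cannot vanish together, so the strict condition on
    [dot] may be relaxed to the closed one. *)
Lemma closed_in_S i : (1 <= i <= n)%N ->
  closed_in (S_ n alpha i) (complement n alpha).
Proof.
move=> i1n; exists (~` ([set z : cplane R | cross mu b c i z.1 z.2 <> 0] `|`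
  [set z | 0 < dot mu b c i z.1 z.2])).
  apply: open_closedC; apply: openU; [apply: open_neq0 | apply: open_pos];
    apply: continuous_rational.
    exact: rational_cross.
  exact: rational_dot.
rewrite S_E // complementE; apply/seteqP; split=> z /=.
  move=> [nz cr dt]; split=> //; case=> //.
  by apply/negP; rewrite -leNgt ltW.
move=> [/not_orP[/contrapT cr /negP dt] nz]; split=> //.
rewrite lt_neqAle leNgt dt andbT; apply/eqP.
exact: (nonvanishing_dot_neq0 conf).
Qed.

End Transfer.

Theorem theorem4p2 (R : realType) (n : nat) (alpha : nat -> affpoly R)
    (a : nat -> R) (Hnorm : normalized n alpha a) :
  (forall i, (1 <= i <= n)%N ->
     closed_in (S_ n alpha i) (complement n alpha) /\
     submanifold 3 (S_ n alpha i)) /\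
  (forall i j, (1 <= i <= n)%N -> (1 <= j <= n)%N -> i <> j ->
     [/\ transverse (S_ n alpha i) (S_ n alpha j),
         S_ n alpha i `&` S_ n alpha j =
           \bigcup_(C in chambers_ij n alpha i j) real_points C &
         trivIset (chambers_ij n alpha i j) (@real_points R)]) /\
  (forall i, (1 <= i <= n)%N ->
     submanifold 3 (S_circ n alpha i) /\ contractible R (S_circ n alpha i)) /\
  (submanifold 4 (U_ n alpha) /\ contractible R (U_ n alpha)).
Proof.
have conf := normalized_configuration Hnorm.
split; [|split; [|split]].
- move=> i i1n; split; first exact: (closed_in_S Hnorm).
  by rewrite (S_E Hnorm) //; exact: (submanifold_in_S conf).
- move=> i j i1n j1n ij; split; first last.
  + by apply: (trivIset_chambers Hnorm) => C [].
  + exact: (S_meetE Hnorm).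
  + by rewrite !(S_E Hnorm) //; exact: (transverse_in_S conf).
- move=> i i1n; rewrite (S_circE Hnorm) //; split.
    exact: (submanifold_in_S_circ conf).
  exact: (contractible_in_S_circ conf).
rewrite (U_E Hnorm); split; last exact: (contractible_in_U conf).
by apply: submanifold_open_cplane; exact: open_in_U.
Qed.
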